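(* Let $z,z',w,w'\in\mathbb C$ satisfy $(z+k)(z'+k)>0$ and $(w+k)(w'+k)>0$ for all $k\in\mathbb Z$, and $z+z'+w+w'>-1$. For $N\ge1$ let $(P_N(t))_{t\ge0}$ be the Markov semigroup on $\mathbb{GT}_N$ with matrix of transition rates $\mathcal D^{(N)}$ taken with parameters $(u,u',v,v')=(z+N-1,\,z'+N-1,\,w,\,w')$. Then $$P_{N+1}(t)\,\Lambda^{N+1}_N=\Lambda^{N+1}_N\,P_N(t),\qquad t\ge0,\quad N=1,2,\dots.$$
   Context: For $N\ge1$, $\mathbb{GT}_N$ is the set of signatures $\lambda=(\lambda_1\ge\dots\ge\lambda_N)\in\mathbb Z^N$, and $\mathrm{Dim}_N\lambda=\prod_{1\le i<j\le N}(\lambda_i-i-\lambda_j+j)\big/\prod_{i=1}^{N-1}i!$. For $\nu\in\mathbb{GT}_N$, $\lambda\in\mathbb{GT}_{N+1}$ write $\nu\prec\lambda$ if $\lambda_1\ge\nu_1\ge\lambda_2\ge\nu_2\ge\dots\ge\nu_N\ge\lambda_{N+1}$. The stochastic matrix $\Lambda^{N+1}_N$ (rows indexed by $\mathbb{GT}_{N+1}$, columns by $\mathbb{GT}_N$) is $\Lambda^{N+1}_N(\lambda,\nu)=\mathrm{Dim}_N\nu/\mathrm{Dim}_{N+1}\lambda$ if $\nu\prec\lambda$ and $0$ otherwise. For parameters $(u,u',v,v')$, $\mathcal D^{(N)}$ is the matrix on $\mathbb{GT}_N\times\mathbb{GT}_N$ whose nonzero off-diagonal entries are, with $l_j=\lambda_j+N-j$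 and $e_i$ the $i$-th standard basis vector, $$\mathcal D^{(N)}(\lambda,\lambda+e_i)=(l_i-u)(l_i-u')\prod_{j\ne i}\frac{l_i+1-l_j}{l_i-l_j},\qquad \mathcal D^{(N)}(\lambda,\lambda-e_i)=(l_i+v)(l_i+v')\prod_{j\ne i}\frac{l_i-1-l_j}{l_i-l_j}$$ (when $\lambda\pm e_i\in\mathbb{GT}_N$), and whose diagonal entries make all row sums zero. The Markov semigroup with this matrix of transition rates is the minimal nonnegative solution $P_N(t)$ of Kolmogorov's backward equation $\frac{d}{dt}P_N(t)=\mathcal D^{(N)}P_N(t)$ with $P_N(0)=\mathrm{Id}$; for the parameters in the claim this minimal solution consists of stochastic matrices and is the unique solution in the class of substochastic matrices. *)

(* Defs.v *)
From HB Require Import structures.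
From mathcomp Require Import all_boot all_order all_algebra.
From mathcomp Require Import complex ring.
From mathcomp Require Import all_classical all_reals all_analysis.

Set Implicit Arguments.
Unset Strict Implicit.
Unset Printing Implicit Defensive.

Import Order.TTheory GRing.Theory Num.Theory.
Import numFieldNormedType.Exports.

Local Open Scope classical_set_scope.
Local Open Scope ring_scope.

(* Coordinates are indexed by 0, ..., N-1 instead of 1, ..., N. *)
Definition is_signature (N : nat) (f : {ffun 'I_N -> int}) : bool :=
  [forall i : 'I_N, forall j : 'I_N, (i <= j)%N ==> (f j <= f i)].

Record GT (N : nat) := Signature {
  sig_val :> {ffun 'I_N -> int};
  _ : is_signature sig_val
}.

HB.instance Definition _ (N : nat) := [isSub for @sig_val N].
HB.instance Definition _ (N : nat) := [Countable of GT N by <:].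

Section GelfandTsetlin.
Context {R : realType}.

Definition Dim (N : nat) (lam : GT N) : R :=
  (\prod_(i < N) \prod_(j < N | (i < j)%N)
      (lam i - (i : nat)%:Z - lam j + (j : nat)%:Z)%:~R)
  / (\prod_(1 <= i < N) (i`!)%:R).

Definition interlace (N : nat) (nu : GT N) (lam : GT N.+1) : bool :=
  [forall i : 'I_N, (nu i <= lam (widen_ord (leqnSn N) i)) &&
                    (lam (lift ord0 i) <= nu i)].

Definition Lambda (N : nat) (lam : GT N.+1) (nu : GT N) : R :=
  if interlace nu lam then Dim nu / Dim lam else 0.

(* l_j = lambda_j + N - j for 1-based j *)
Definition lcoord (N : nat) (lam : GT N) (j : 'I_N) : int :=
  lam j + N%:Z - (j.+1)%:Z.

Definition add_e (N : nat) (lam : GT N) (i : 'I_N) (e : int) :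
    {ffun 'I_N -> int} :=
  [ffun j => lam j + (if j == i then e else 0)].

Section Rates.
Variables (u u' v v' : R[i]) (N : nat).

Definition rate_up (lam : GT N) (i : 'I_N) : R[i] :=
  let l j : R[i] := (lcoord lam j)%:~R in
  (l i - u) * (l i - u') * \prod_(j < N | j != i) ((l i + 1 - l j) / (l i - l j)).

Definition rate_down (lam : GT N) (i : 'I_N) : R[i] :=
  let l j : R[i] := (lcoord lam j)%:~R in
  (l i + v) * (l i + v') * \prod_(j < N | j != i) ((l i - 1 - l j) / (l i - l j)).

(* For given lam and mu, at most one index contributes to the two sums. *)
Definition Doff (lam mu : GT N) : R[i] :=
  \sum_(i < N | sig_val mu == add_e lam i 1) rate_up lam i
  + \sum_(i < N | sig_val mu == add_e lam i (-1)) rate_down lam i.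

(* The sum is over a finite support, as required by [\sum_(_ \in _)]. *)
Definition Dmat (lam mu : GT N) : R[i] :=
  if lam == mu then - \sum_(nu \in [set nu | nu != lam]) Doff lam nu
  else Doff lam mu.

(* The entries of [Dmat] are real for the parameters of interest: see
   [Dmat_rateE] below. *)
Definition Drate (lam mu : GT N) : R := complex.Re (Dmat lam mu).

End Rates.

Lemma Dmat_rateE (z z' w w' : R[i]) (N : nat) (lam mu : GT N) :
  (forall k : int, 0 < (z + k%:~R) * (z' + k%:~R)) ->
  (forall k : int, 0 < (w + k%:~R) * (w' + k%:~R)) ->
  real_complex R (Drate (z + N%:R - 1) (z' + N%:R - 1) w w' lam mu) =
  Dmat (z + N%:R - 1) (z' + N%:R - 1) w w' lam mu.
Proof.
move=> hz hw; apply: RRe_real.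
have intr_real (k : int) : (k%:~R : R[i]) \is Num.real by rewrite realz.
have up_real kap i : rate_up (z + N%:R - 1) (z' + N%:R - 1) kap i \is Num.real.
  rewrite /rate_up; apply: realM; last first.
    by apply: rpred_prod => j _; rewrite ?(rpredM, rpredV, rpredB, rpredD, rpred1).
  have -> : ((lcoord kap i)%:~R - (z + N%:R - 1)) *
            ((lcoord kap i)%:~R - (z' + N%:R - 1)) =
     (z + (N%:Z - 1 - lcoord kap i)%:~R) * (z' + (N%:Z - 1 - lcoord kap i)%:~R).
    rewrite !rmorphB /= -pmulrn; ring.
  exact: gtr0_real.
have down_real kap i : rate_down w w' kap i \is Num.real.
  rewrite /rate_down; apply: realM; last first.
    by apply: rpred_prod => j _; rewrite ?(rpredM, rpredV, rpredB, rpredD, rpred1).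
  by rewrite ![_%:~R + _]addrC; exact: gtr0_real.
have off_real kap1 kap2 :
    Doff (z + N%:R - 1) (z' + N%:R - 1) w w' kap1 kap2 \is Num.real.
  by rewrite /Doff rpredD // rpred_sum.
rewrite /Dmat; case: ifP => _ //.
by rewrite rpredN rpred_sum.
Qed.
End GelfandTsetlin.

Section Kolmogorov.
Context {R : realType} {T : countType}.
Implicit Types (Q : T -> T -> R) (P : R -> T -> T -> R).

(* Matrix product Q A for Q with finitely many nonzero entries in each row
   ([\sum_(_ \in _)] is 0 on infinite supports). *)
Definition rowfin_mul Q (A : T -> T -> R) (x y : T) : R :=
  \sum_(k \in [set: T]) (Q x k * A k y).

(* P is a nonnegative solution on [0, +oo[ of P'(t) = Q P(t), P(0) = Id, the
   derivative at 0 being one-sided; values P t with t < 0 are irrelevant. *)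
Definition nonneg_backward_solution Q P : Prop :=
  [/\ forall (t : R) x y, 0 <= t -> 0 <= P t x y,
      forall x y, P 0 x y = (x == y)%:R,
      forall (t : R) x y, 0 < t ->
        is_derive t (1 : R) (fun s : R => P s x y) (rowfin_mul Q (P t) x y)
    & forall x y,
        h^-1 * (P h x y - P 0 x y) @[h --> 0^'+] --> rowfin_mul Q (P 0) x y].

Definition minimal_backward_solution Q P : Prop :=
  nonneg_backward_solution Q P /\
  forall P', nonneg_backward_solution Q P' ->
    forall (t : R) x y, 0 <= t -> P t x y <= P' t x y.

End Kolmogorov.

(* Product of matrices with nonnegative entries, as sums in [0, +oo]. *)
Definition kernel_mul (R : realType) (S T U : countType)
    (A : S -> T -> R) (B : T -> U -> R) (x : S) (y : U) : \bar R :=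
  \esum_(k in [set: T]) (A x k * B k y)%:E.

(* Main.v *)
Require Import Defs.
From mathcomp Require Import all_boot all_order all_algebra.
From mathcomp Require Import complex ring lra zify.
From mathcomp Require Import all_classical all_reals all_analysis.
Import Order.TTheory GRing.Theory Num.Theory.
Import numFieldNormedType.Exports.
Local Open Scope classical_set_scope.
Local Open Scope ring_scope.

(** Fix a signature nu of length N.  The functions
    X_t = (P_{N+1}(t) Lambda)(., nu) and Y_t = (Lambda P_N(t))(., nu) on the
    signatures of length N+1 both start from Lambda(., nu).  Both solve the
    backward equation of D^{(N+1)}: for X this is the equation of P_{N+1}, and
    for Y it follows from that of P_N and from the matrix identity
    D^{(N+1)} Lambda = Lambda D^{(N)} ([Lambda_intertwines]).  So X = Y as soon
    as bounded solutions of this equation are determined by their initial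
    value, which expresses that the chain does not explode.

    Uniqueness comes from a maximum principle ([flow_comparison]).  It needs a
    function F >= 0 with finite level sets such that D^{(N+1)} F <= C F; here
    F = 1 + sum of the l_i^2 does it ([jump_matrix_lyapunov]).  The infinite sum
    in X is handled by comparing Y with the finite sums that approximate X
    ([minimal_solution_intertwining]).

    The comparison applies to bounded solutions only, so one needs that a
    minimal solution has entries at most 1 ([minimal_solution_le1]).  By
    minimality it suffices to exhibit one nonnegative solution bounded by 1.
    Such a solution is a limit, along an ultrafilter, of the Euler schemes
    (I + D/n)^{[nt]} in which the states of total rate above n are frozen: these
    are powers of stochastic matrices, and a second order Taylor bound uniform
    in n survives in the limit and yields the derivative
    ([euler_limit_taylor]).

    The algebra rests on one observation: with a(x), b(x) the quadratic birth
    and death rates, D^{(N)} is the conjugate by the Vandermonde product V of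
    the sum over i of the one-variable operators
    f -> a (f(x+1) - f(x)) + b (f(x-1) - f(x)), up to a constant.  Indeed these
    operators act triangularly on monomials, so that V is an eigenfunction of
    their sum ([vdm_eigen]).  After conjugation Lambda becomes, up to constants,
    the indicator that the coordinates of nu lie in the successive intervals
    delimited by those of lambda, and the identity D^{(N+1)} Lambda =
    Lambda D^{(N)} is an exchange between moving an end of an interval and
    moving a point ([slots_exchange], [kernel_identity]).  The same
    eigenrelation in N+1 variables, with one variable set apart, shows that the
    generator acts triangularly on elementary symmetric functions
    ([multi_op_dual], [gen_root_poly_coef]); this gives the bound on D F. *)

(** * Actions of row-finite matrices *)

Section RowAction.
Context {R : realType} {S T : choiceType}.
Implicit Types (Q : S -> T -> R) (f g : T -> R).

Definition row_finite Q :=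
  forall x, exists r : seq T, uniq r /\ forall y, y \notin r -> Q x y = 0.

Definition act Q f (x : S) : R := \sum_(y \in [set: T]) Q x y * f y.

Lemma actE Q x (r : seq T) : uniq r -> (forall y, y \notin r -> Q x y = 0) ->
  forall f, act Q f x = \sum_(y <- r) Q x y * f y.
Proof.
move=> ur hr f; rewrite /act (fsbigE r) //.
  by apply: eq_bigl => y; rewrite in_setT.
by move=> y _ /hr ->; rewrite mul0r.
Qed.

Variable Q : S -> T -> R.
Hypothesis finQ : row_finite Q.

Lemma actD f g x : act Q (fun y => f y + g y) x = act Q f x + act Q g x.
Proof.
have [r [ur hr]] := finQ x; rewrite !(actE _ _ _ ur hr) -big_split /=.
by apply: eq_bigr => y _; rewrite mulrDr.
Qed.

Lemma actZ a f x : act Q (fun y => a * f y) x = a * act Q f x.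
Proof.
have [r [ur hr]] := finQ x; rewrite !(actE _ _ _ ur hr) big_distrr /=.
by apply: eq_bigr => y _; rewrite mulrCA.
Qed.

Lemma actB f g x : act Q (fun y => f y - g y) x = act Q f x - act Q g x.
Proof.
rewrite -[- act _ _ _]mulN1r -actZ -actD.
by congr (act Q _ x); apply: funext => y; rewrite mulN1r.
Qed.

Lemma act0 x : act Q (fun=> 0) x = 0.
Proof. by rewrite /act fsbig1 // => y _; rewrite mulr0. Qed.

Lemma act_sum (I : Type) (s : seq I) (F : I -> T -> R) x :
  act Q (fun y => \sum_(i <- s) F i y) x = \sum_(i <- s) act Q (F i) x.
Proof.
elim: s => [|i s IH].
  by rewrite big_nil -[RHS](act0 x); congr act; apply: funext => y; rewrite big_nil.
rewrite big_cons -IH -actD; congr act; apply: funext => y.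
by rewrite big_cons.
Qed.

Lemma act_abs f g x : (forall y, `|f y| <= g y) ->
  `|act Q f x| <= act (fun x y => `|Q x y|) g x.
Proof.
move=> fg; have [r [ur hr]] := finQ x; rewrite (actE _ _ _ ur hr).
rewrite (actE _ _ r) //; last by move=> y /hr ->; rewrite normr0.
apply: le_trans (ler_norm_sum _ _ _) _; apply: ler_sum => y _.
by rewrite normrM ler_wpM2l.
Qed.

End RowAction.

Lemma row_finite_abs {R : realType} {S T : choiceType} (Q : S -> T -> R) :
  row_finite Q -> row_finite (fun x y => `|Q x y|).
Proof.
by move=> h x; have [r [ur hr]] := h x; exists r; split=> // y /hr ->; rewrite normr0.
Qed.

Section UltrafilterLimit.
Context {R : realType}.

(** A limit along an ultrafilter is linear and exists for every bounded
    sequence, so no subsequence has to be extracted for each matrix entry. *)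
Lemma nat_ultrafilter : exists U : set_system nat, UltraFilter U /\ \oo `<=` U.
Proof. exact: ultraFilterLemma. Qed.

(** The image of an ultrafilter is an ultrafilter, and [0, 1] is compact. *)
Lemma bounded_ultra_cvg (U : set_system nat) (u : nat -> R) : UltraFilter U ->
  (forall n, 0 <= u n <= 1) -> exists l : R, u @ U --> l.
Proof.
move=> UU u01.
have UuU : UltraFilter (u @ U).
  split; first exact: fmap_proper_filter.
  move=> G GF sG; rewrite predeqE => A; split; last exact: sG.
  move=> GA; have [//|UnA] := in_ultra_setVsetC (u @^-1` A) UU.
  have GnA : G (~` A) by apply: sG.
  by have /filter_ex [? []] : G (A `&` ~` A) by exact: filterI.
have := @segment_compact R 0 1; rewrite compact_ultra => /(_ (u @ U) UuU).
case=> [|l [_ ul]]; last by exists l.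
by apply: (@filterE _ U) => n; rewrite /= in_itv; exact: u01.
Qed.

End UltrafilterLimit.

(** * Euler schemes of a conservative rate matrix *)

Section MarkovGenerator.
Context {R : realType} {T : countType} (Q : T -> T -> R).

Definition conservative :=
  [/\ row_finite Q, (forall x y, x != y -> 0 <= Q x y)
    & forall x, act Q (fun=> 1) x = 0].

Hypothesis consQ : conservative.
Let finQ : row_finite Q. Proof. by case: consQ. Qed.
Let offQ x y : x != y -> 0 <= Q x y. Proof. by case: consQ => _ h _; exact: h. Qed.
Let rowQ x : act Q (fun=> 1) x = 0. Proof. by case: consQ. Qed.

Lemma act_cst (c : R) x : act Q (fun=> c) x = 0.
Proof.
have -> : (fun=> c) = (fun _ : T => c * 1) by apply: funext => y; rewrite mulr1.
by rewrite actZ // rowQ mulr0.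
Qed.

Lemma row_finite_mem x : exists r : seq T,
  [/\ uniq r, x \in r & forall y, y \notin r -> Q x y = 0].
Proof.
have [r [ur hr]] := finQ x; exists (undup (x :: r)); split.
- exact: undup_uniq.
- by rewrite mem_undup mem_head.
- by move=> y; rewrite mem_undup inE negb_or => /andP[_ /hr].
Qed.

Lemma act_ge_diag f x : (forall y, 0 <= f y) -> Q x x * f x <= act Q f x.
Proof.
move=> f0; have [r [ur xr hr]] := row_finite_mem x.
rewrite (actE _ _ _ ur hr) (bigD1_seq x) //= lerDl sumr_ge0 // => y yx.
by rewrite mulr_ge0 // offQ // eq_sym.
Qed.

(** The maximum principle in discrete form: at a maximum of [f] all
    differences [f y - f x] are nonpositive and are weighted by nonnegative
    rates. *)
Lemma act_le_max f x : (forall y, f y <= f x) -> act Q f x <= 0.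
Proof.
move=> fx; have [r [ur xr hr]] := row_finite_mem x.
rewrite -[leRHS](act_cst (f x) x) !(actE _ _ _ ur hr); apply: ler_sum => y _.
have [->//|yx] := eqVneq y x.
by rewrite ler_wpM2l // offQ // eq_sym.
Qed.

(** The step is 1/(n+1) where the total rate is at most [n.+1] and 0 elsewhere.
    Freezing the fast states makes [I + step Q] a stochastic matrix; any given
    state is frozen for finitely many [n] only. *)
Definition euler_step (n : nat) (x : T) : R :=
  if - Q x x <= n.+1%:R then n.+1%:R^-1 else 0.

Definition euler n (f : T -> R) (x : T) : R := f x + euler_step n x * act Q f x.

Lemma euler_step_ge0 n x : 0 <= euler_step n x.
Proof. by rewrite /euler_step; case: ifP => // _; rewrite invr_ge0. Qed.

Lemma euler_step_le n x : euler_step n x <= n.+1%:R^-1.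
Proof. by rewrite /euler_step; case: ifP => // _; rewrite invr_ge0. Qed.

Lemma euler_ge0 n f x : (forall y, 0 <= f y) -> 0 <= euler n f x.
Proof.
move=> f0; rewrite /euler /euler_step; case: ifP => [qn|_]; last first.
  by rewrite mul0r addr0.
apply: (@le_trans _ _ (f x + n.+1%:R^-1 * (Q x x * f x))); last first.
  by rewrite lerD2l ler_wpM2l ?invr_ge0 // act_ge_diag.
rewrite mulrA -[X in X + _]mul1r -mulrDl mulr_ge0 //.
by rewrite -lerBlDr sub0r -mulrN mulrC ler_pdivrMr ?ltr0n // mul1r.
Qed.

Lemma euler_ge0_le1 n f x : (forall y, 0 <= f y <= 1) -> 0 <= euler n f x <= 1.
Proof.
move=> f01; rewrite euler_ge0 /=; last by move=> y; case/andP: (f01 y).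
rewrite -subr_ge0.
have -> : 1 - euler n f x = euler n (fun y => 1 - f y) x.
  by rewrite /euler actB // rowQ sub0r mulrN; ring.
by apply: euler_ge0 => y; rewrite subr_ge0; case/andP: (f01 y).
Qed.

(** [rate_bound1 x] and [rate_bound2 x] are the row sums of |Q| and |Q|^2; they
    bound the first and second time derivatives at [x] of a solution with
    values in [0, 1]. *)
Definition rate_bound1 x := act (fun x y => `|Q x y|) (fun=> 1) x.
Definition rate_bound2 x := act (fun x y => `|Q x y|) rate_bound1 x.

Lemma rate_bound1_ge0 x : 0 <= rate_bound1 x.
Proof.
apply: le_trans (normr_ge0 (act Q (fun=> 1) x)) _.
by apply: act_abs => // y; rewrite normr1.
Qed.

Lemma rate_bound2_ge0 x : 0 <= rate_bound2 x.
Proof.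
apply: le_trans (normr_ge0 (act Q rate_bound1 x)) _.
by apply: act_abs => // y; rewrite ger0_norm // rate_bound1_ge0.
Qed.

Variables (f0 : T -> R).
Hypothesis f01 : forall y, 0 <= f0 y <= 1.

Definition euler_iter n k := iter k (euler n) f0.

Lemma euler_iter01 n k x : 0 <= euler_iter n k x <= 1.
Proof. by elim: k x => // k IH x; exact: euler_ge0_le1. Qed.

Lemma act_euler_iter n k x : `|act Q (euler_iter n k) x| <= rate_bound1 x.
Proof.
apply: act_abs => // y; case/andP: (euler_iter01 n k y) => h0 h1.
by rewrite ger0_norm.
Qed.

Lemma euler_lipschitz n k m x :
  `|euler_iter n (k + m) x - euler_iter n k x| <= m%:R / n.+1%:R * rate_bound1 x.
Proof.
elim: m => [|m IH]; first by rewrite addn0 subrr normr0 !mul0r.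
rewrite addnS /= {1}/euler.
set a := euler_iter n (k + m) x in IH *.
set b := act _ _ _; set c := euler_iter n k x in IH *.
have -> : a + euler_step n x * b - c = (a - c) + euler_step n x * b by ring.
apply: le_trans (ler_normD _ _) _.
rewrite -natr1 2!mulrDl mul1r lerD // normrM (ger0_norm (euler_step_ge0 _ _)).
by apply: ler_pM; rewrite ?euler_step_ge0 ?euler_step_le //; exact: act_euler_iter.
Qed.

(** The discrete version of the bound h^2 sup |p''| on the Taylor remainder: an
    increment of [m] steps differs from [m] times the first one by at most [m]
    step lengths times the variation of [Q p] over these steps. *)
Lemma euler_taylor n k m x :
  `|euler_iter n (k + m) x - euler_iter n k x
     - m%:R * euler_step n x * act Q (euler_iter n k) x|
  <= (m%:R / n.+1%:R) ^+ 2 * rate_bound2 x.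
Proof.
elim: m => [|m IH].
  by rewrite addn0 subrr !mul0r subr0 normr0 expr0n /= mul0r.
rewrite addnS /= {1}/euler.
set a := euler_iter n (k + m) x in IH *; set c := euler_iter n k x in IH *.
set s := euler_step n x in IH *.
set B := act Q (iter _ _ _) x; set C := act Q (euler_iter n k) x in IH *.
have -> : a + s * B - c - m.+1%:R * s * C = (a - c - m%:R * s * C) + s * (B - C).
  by rewrite -natr1; ring.
apply: le_trans (ler_normD _ _) _.
have BC : `|B - C| <= m%:R / n.+1%:R * rate_bound2 x.
  rewrite /B /C -actB // /rate_bound2 -actZ; last exact: row_finite_abs.
  by apply: act_abs => // y; exact: euler_lipschitz.
have sBC : `|s * (B - C)| <= n.+1%:R^-1 * (m%:R / n.+1%:R * rate_bound2 x).
  rewrite normrM (ger0_norm (euler_step_ge0 _ _)).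
  by apply: ler_pM; rewrite ?euler_step_ge0 ?euler_step_le.
apply: le_trans (lerD IH sBC) _.
rewrite mulrA -mulrDl ler_wpM2r ?rate_bound2_ge0 //.
rewrite -[m.+1%:R]natr1; set i := n.+1%:R^-1; set j := m%:R.
have i0 : 0 <= i by rewrite invr_ge0.
have j0 : 0 <= j by rewrite ler0n.
rewrite -subr_ge0.
have -> : ((j + 1) * i) ^+ 2 - ((j * i) ^+ 2 + i * (j * i)) = i * i * (j + 1).
  by ring.
by rewrite !mulr_ge0 // addr_ge0.
Qed.

Definition euler_time (t : R) (n : nat) := Num.truncn (t * n.+1%:R).

Lemma euler_timeP (t : R) n : 0 <= t ->
  (euler_time t n)%:R / n.+1%:R <= t /\
  t < (euler_time t n)%:R / n.+1%:R + n.+1%:R^-1.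
Proof.
move=> t0; have /truncn_itv : 0 <= t * n.+1%:R by rewrite mulr_ge0.
rewrite -/(euler_time t n) => /andP[h1 h2]; split.
  by rewrite ler_pdivrMr ?ltr0n.
by rewrite -[X in _ < _ + X]mul1r -mulrDl natr1 ltr_pdivlMr ?ltr0n.
Qed.

Lemma euler_time_le (s t : R) n : 0 <= s <= t -> (euler_time s n <= euler_time t n)%N.
Proof.
move=> /andP[s0 st]; apply: le_truncn.
by rewrite ler_wpM2r.
Qed.

Lemma cvg_euler_time (t : R) : 0 <= t ->
  (euler_time t n)%:R / n.+1%:R @[n --> \oo] --> t.
Proof.
move=> t0; apply: (@squeeze_cvgr _ _ _ _ (fun n => t - harmonic n) (fun=> t)).
- apply: nearW => n; have [h1 h2] := euler_timeP t n t0.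
  by rewrite h1 andbT lerBlDr ltW.
- rewrite -[X in _ --> X]subr0; apply: cvgB; first exact: cvg_cst.
  exact: cvg_harmonic.
- exact: cvg_cst.
Qed.

Variable U : set_system nat.
Hypotheses (UU : UltraFilter U) (ooU : \oo `<=` U).

Let toU (u : nat -> R) (l : R) : u n @[n --> \oo] --> l -> u n @[n --> U] --> l.
Proof. by move=> ul A /ul /ooU. Qed.

Definition euler_limit (t : R) (x : T) : R :=
  lim (euler_iter n (euler_time t n) x @[n --> U]).

Lemma cvg_euler_limit (t : R) x :
  euler_iter n (euler_time t n) x @[n --> U] --> euler_limit t x.
Proof.
have [l ul] := bounded_ultra_cvg U _ UU
  (fun n => euler_iter01 n (euler_time t n) x).
by apply: (cvgP l).
Qed.

Lemma euler_limit_ge0_le1 t x : 0 <= euler_limit t x <= 1.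
Proof.
apply/andP; split.
- apply: (cvgr_to_ge (cvg_euler_limit t x)); apply: nearW => n.
  by case/andP: (euler_iter01 n (euler_time t n) x).
- apply: (cvgr_to_le (cvg_euler_limit t x)); apply: nearW => n.
  by case/andP: (euler_iter01 n (euler_time t n) x).
Qed.

Lemma euler_limit0 x : euler_limit 0 x = f0 x.
Proof.
apply: cvg_lim => //.
apply: toU; apply: cvg_near_cst; apply: nearW => n.
by rewrite /euler_time mul0r truncn0.
Qed.

Lemma euler_limit_lipschitz t h x : 0 <= t -> 0 <= h ->
  `|euler_limit (t + h) x - euler_limit t x| <= h * rate_bound1 x.
Proof.
move=> t0 h0; have th0 : 0 <= t + h by rewrite addr_ge0.
pose d n : R := (euler_time (t + h) n)%:R / n.+1%:R - (euler_time t n)%:R / n.+1%:R.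
have dh : d n @[n --> U] --> h.
  rewrite (_ : h = t + h - t); last by ring.
  by apply: toU; apply: cvgB; exact: cvg_euler_time.
have dhR : d n * rate_bound1 x @[n --> U] --> h * rate_bound1 x by exact: cvgMl.
apply: (ler_cvg_to (cvg_norm (cvgB (cvg_euler_limit (t + h) x)
  (cvg_euler_limit t x))) dhR).
apply: nearW => n /=.
have le_tth : (euler_time t n <= euler_time (t + h) n)%N.
  by apply: euler_time_le; rewrite t0 lerDl.
have := euler_lipschitz n (euler_time t n) (euler_time (t + h) n - euler_time t n) x.
by rewrite subnKC // natrB // mulrBl.
Qed.

(** All the information about derivatives passes to the limit in this one
    inequality, since [act Q] is a finite sum and the frozen states disappear. *)
Lemma euler_limit_taylor t h x : 0 <= t -> 0 <= h ->
  `|euler_limit (t + h) x - euler_limit t x - h * act Q (euler_limit t) x|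
  <= h ^+ 2 * rate_bound2 x.
Proof.
move=> t0 h0; have th0 : 0 <= t + h by rewrite addr_ge0.
pose d n : R := (euler_time (t + h) n)%:R / n.+1%:R - (euler_time t n)%:R / n.+1%:R.
have dh : d n @[n --> U] --> h.
  rewrite (_ : h = t + h - t); last by ring.
  by apply: toU; apply: cvgB; exact: cvg_euler_time.
have cvg_act : act Q (euler_iter n (euler_time t n)) x @[n --> U]
    --> act Q (euler_limit t) x.
  have [r [ur hr]] := finQ x; rewrite (actE _ _ _ ur hr).
  under eq_fun do rewrite (actE _ _ _ ur hr).
  apply: cvg_big => [|y _]; first exact: add_continuous.
  by apply: cvgMr; exact: cvg_euler_limit.
have cvg_d2 : d n ^+ 2 * rate_bound2 x @[n --> U] --> h ^+ 2 * rate_bound2 x.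
  by apply: cvgMl; rewrite expr2; apply: cvgM.
apply: (ler_cvg_to (cvg_norm (cvgB (cvgB (cvg_euler_limit (t + h) x)
  (cvg_euler_limit t x)) (cvgM dh cvg_act))) cvg_d2).
have : \forall n \near U, - Q x x <= n.+1%:R.
  apply: ooU; exists (Num.truncn `|Q x x|) => // n /= hn.
  apply: le_trans (ler_norm _) _; rewrite normrN ltW //.
  apply: lt_le_trans (truncnS_gt _) _.
  by rewrite ler_nat.
apply: filterS => n qn /=.
have le_tth : (euler_time t n <= euler_time (t + h) n)%N.
  by apply: euler_time_le; rewrite t0 lerDl.
have := euler_taylor n (euler_time t n) (euler_time (t + h) n - euler_time t n) x.
by rewrite subnKC // natrB // /euler_step qn mulrBl.
Qed.

End MarkovGenerator.

(** * A bounded solution of the backward equation *)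

Lemma is_derive_of_quadratic {R : realType} (f : R -> R) (t l C d : R) : 0 < d ->
  (forall h, `|h| < d -> `|f (t + h) - f t - h * l| <= h ^+ 2 * C) ->
  is_derive t (1 : R) f l.
Proof.
move=> d0 hf.
have cf : h^-1 *: (f (h *: (1 : R) + t) - f t) @[h --> 0^'] --> l.
  apply/cvgrPdist_le => e e0; near=> h.
  have h0 : h != 0 by near: h; exact: nbhs_dnbhs_neq.
  have hd : `|h| < d by near: h; apply: dnbhs0_lt.
  have he : `|h| < e / (`|C| + 1).
    by near: h; apply: dnbhs0_lt; rewrite divr_gt0 // ltr_wpDl.
  have nh0 : 0 < `|h| by rewrite normr_gt0.
  rewrite [_ *: 1]mulr1 [h + t]addrC -[_ *: _]/(_ * _).
  have -> : l - h^-1 * (f (t + h) - f t) = - h^-1 * (f (t + h) - f t - h * l).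
    by field.
  rewrite normrM normrN normfV ler_pdivrMl //; apply: le_trans (hf _ hd) _.
  rewrite -[h ^+ 2]ger0_norm ?sqr_ge0 // normrX expr2 -mulrA ler_wpM2l //.
  move: he; rewrite ltr_pdivlMr ?ltr_wpDl // => /ltW; apply: le_trans.
  rewrite ler_wpM2l // (le_trans (ler_norm _)) // lerDl //.
apply: DeriveDef; first by apply/cvg_ex; exists l; exact: cf.
by apply: cvg_lim => //; exact: cf.
Unshelve. all: by end_near. Qed.

(** At time 0 only continuity is asked for, which is what the maximum principle
    uses. *)
Definition backward_flow {R : realType} {S : choiceType} (Q : S -> S -> R)
    (X : R -> S -> R) :=
  (forall (t : R) x, 0 < t -> is_derive t (1 : R) (fun s => X s x) (act Q (X t) x))
  /\ forall x, X h x @[h --> 0^'+] --> X 0 x.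

Lemma nonneg_solution_flow {R : realType} {T : countType} (Q : T -> T -> R) P y :
  nonneg_backward_solution Q P -> backward_flow Q (fun t x => P t x y).
Proof.
move=> [P0 P1 P2 P3]; split=> [t x t0|x]; first exact: P2.
have cid0 : h @[h --> (0 : R)^'+] --> 0.
  by apply: cvg_at_right_filter; exact: cvg_id.
rewrite -[X in _ --> X]addr0 -[X in _ + X](mul0r (rowfin_mul Q (P 0) x y)).
apply: cvg_trans (cvgD (cvg_cst (P 0 x y)) (cvgM cid0 (P3 x y))).
apply: near_eq_cvg; near=> h.
have h0 : h != 0 by rewrite gt_eqF //; near: h; exact: nbhs_right_gt.
by rewrite !fctE /= mulVKf // addrC subrK.
Unshelve. all: by end_near. Qed.

Section BoundedSolution.
Context {R : realType} {T : countType} (Q : T -> T -> R).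
Hypothesis consQ : conservative Q.
Let finQ : row_finite Q. Proof. by case: consQ. Qed.

(** The Taylor bound for increments to the right determines the derivative at
    every time: an increment to the left is one to the right from the earlier
    time, up to the variation of [Q p], which is Lipschitz. *)
Lemma bounded_backward_solution : exists P,
  nonneg_backward_solution Q P /\ forall t x y, P t x y <= 1.
Proof.
have [U [UU ooU]] := nat_ultrafilter.
have d01 (y k : T) : 0 <= ((k == y)%:R : R) <= 1 by rewrite ler0n lern1 leq_b1.
pose d (y k : T) : R := (k == y)%:R.
pose p t x y := euler_limit Q (d y) U t x.
have p01 t x y : 0 <= p t x y <= 1 by exact: (euler_limit_ge0_le1 _ consQ _ (d01 y) _ UU).
pose C x := 2 * rate_bound2 Q x.
have taylor x y t h : 0 <= t -> 0 <= t + h ->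
    `|p (t + h) x y - p t x y - h * act Q (fun k => p t k y) x| <= h ^+ 2 * C x.
  move=> t0 th0.
  have R2 : 0 <= rate_bound2 Q x by exact: rate_bound2_ge0.
  have [h0|h0] := leP 0 h.
    apply: le_trans (euler_limit_taylor _ consQ _ (d01 y) _ UU ooU _ _ x t0 h0) _.
    by rewrite ler_wpM2l ?sqr_ge0 // /C; lra.
  (* An increment to the left is one to the right from the earlier time s. *)
  set s := t + h in th0 *; have ts : t = s + - h by rewrite /s; ring.
  have g0 : 0 <= - h by lra.
  have := euler_limit_taylor _ consQ _ (d01 y) _ UU ooU s (- h) x th0 g0.
  rewrite -ts -/(p t x y) -/(p s x y).
  have : `|act Q (fun k => p t k y) x - act Q (euler_limit Q (d y) U s) x|
      <= - h * rate_bound2 Q x.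
    rewrite -actB // /rate_bound2 -actZ; last exact: row_finite_abs.
    apply: act_abs => // k; rewrite ts.
    exact: (euler_limit_lipschitz _ consQ _ (d01 y) _ UU ooU s (- h) k th0 g0).
  set A := act Q _ x; set B := act Q _ x => AB tB.
  have -> : p s x y - p t x y - h * A =
     - (p t x y - p s x y - - h * B) + (- h) * (A - B) by ring.
  apply: le_trans (ler_normD _ _) _; rewrite normrN [`|- h * _|]normrM.
  have : `|- h| * `|A - B| <= - h * (- h * rate_bound2 Q x).
    by rewrite ger0_norm // ler_wpM2l.
  by move: tB; rewrite /C sqrrN; nra.
exists p; split=> [|t x y]; last by case/andP: (p01 t x y).
split=> [t x y _|x y|t x y t0|x y].
- by case/andP: (p01 t x y).
- exact: euler_limit0.
- apply: (is_derive_of_quadratic _ _ _ (C x) _ t0) => h ht.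
  apply: taylor; first exact: ltW.
  by move: ht; rewrite ltr_norml => /andP[h1 _]; lra.
- apply/cvgrPdist_le => e e0; near=> h.
  have h0 : 0 < h by near: h; exact: nbhs_right_gt.
  have he : h < e / (`|C x| + 1).
    by near: h; apply: nbhs_right_lt; rewrite divr_gt0 // ltr_wpDl.
  have := taylor x y 0 h (lexx _); rewrite add0r => /(_ (ltW h0)).
  rewrite /rowfin_mul -/(act Q (fun k => p 0 k y) x).
  set l := act _ _ _ => tl.
  have -> : l - h^-1 * (p h x y - p 0 x y) = - h^-1 * (p h x y - p 0 x y - h * l).
    by field; rewrite gt_eqF.
  rewrite normrM normrN normfV (gtr0_norm h0) ler_pdivrMl //; apply: le_trans tl _.
  rewrite expr2 -mulrA ler_wpM2l ?(ltW h0) //.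
  move: he; rewrite ltr_pdivlMr ?ltr_wpDl // => /ltW; apply: le_trans.
  by rewrite ler_wpM2l ?(ltW h0) // (le_trans (ler_norm _)) // lerDl.
Unshelve. all: by end_near. Qed.

Lemma minimal_solution_le1 P : minimal_backward_solution Q P ->
  forall t x y, 0 <= t -> P t x y <= 1.
Proof.
move=> [_ Pmin] t x y t0; have [P' [solP' P'1]] := bounded_backward_solution.
exact: le_trans (Pmin _ solP' _ _ _ t0) (P'1 _ _ _).
Qed.

End BoundedSolution.

(** * The maximum principle *)

Section Flows.
Context {R : realType}.

Lemma is_derive_lincomb (I : Type) (r : seq I) (c d : I -> R) (f : I -> R -> R) (t : R) :
  (forall i, is_derive t (1 : R) (f i) (d i)) ->
  is_derive t (1 : R) (fun s => \sum_(i <- r) c i * f i s) (\sum_(i <- r) c i * d i).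
Proof.
move=> fd; elim: r => [|i r IH].
  rewrite big_nil; under eq_fun do rewrite big_nil; exact: is_derive_cst.
rewrite big_cons; under eq_fun do rewrite big_cons.
by apply: is_deriveD; apply: is_deriveZ.
Qed.

Lemma cvg_lincomb (I : Type) (r : seq I) (c d : I -> R) (f : I -> R -> R)
    (F : set_system R) : Filter F -> (forall i, f i s @[s --> F] --> d i) ->
  \sum_(i <- r) c i * f i s @[s --> F] --> \sum_(i <- r) c i * d i.
Proof.
move=> FF fd; apply: cvg_big => [|i _]; first exact: add_continuous.
exact: cvgMr.
Qed.

Lemma left_max_derive (f : R -> R) (t d : R) : 0 < t ->
  (forall s, 0 <= s <= t -> f s <= f t) -> is_derive t (1 : R) f d -> 0 <= d.
Proof.
move=> t0 ft [df <-].
have cf : h^-1 *: (f (h *: (1 : R) + t) - f t) @[h --> 0^'-] --> 'D_1 f t.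
  apply: cvg_trans df; apply: cvg_app => A [e e0 eA]; exists e => // h he h0.
  by apply: eA => //=; rewrite lt_eqF.
apply: (cvgr_to_ge cf); near=> h.
have h0 : h < 0 by near: h; exact: nbhs_left_lt.
have ht : - t < h by near: h; apply: nbhs_left_gt; rewrite oppr_lt0.
rewrite -[_ *: (f _ - _)]/(_ * _) -mulrNN mulr_ge0 //.
  by rewrite oppr_ge0 invr_le0 ltW.
rewrite oppr_ge0 subr_le0 [_ *: 1]mulr1; apply: ft; apply/andP; split; lra.
Unshelve. all: by end_near. Qed.

Lemma seq_argmax (I : eqType) (s : seq I) (g : I -> R) (i : I) : i \in s ->
  exists2 j, j \in s & forall k, k \in s -> g k <= g j.
Proof.
elim: s i => // a s IH i _; case: s IH => [|b s] IH.
  by exists a; rewrite ?mem_head // => k; rewrite inE => /eqP ->.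
have [j js jmax] := IH b (mem_head _ _).
have [gaj|gja] := leP (g a) (g j).
  exists j; first by rewrite inE js orbT.
  by move=> k; rewrite inE => /predU1P[-> //|/jmax].
exists a; rewrite ?mem_head // => k; rewrite inE => /predU1P[-> //|/jmax h].
exact: le_trans h (ltW gja).
Qed.

End Flows.

Section Comparison.
Context {R : realType} {T : countType} (Q : T -> T -> R).
Hypothesis consQ : conservative Q.
Let finQ : row_finite Q. Proof. by case: consQ. Qed.
Variables (F : T -> R) (C : R).

Definition lyapunov := [/\ 0 <= C, forall x, 0 <= F x,
  forall M : R, finite_set [set x | F x <= M] & forall x, act Q F x <= C * F x].

Hypothesis lyapF : lyapunov.

(** [exp(-(C+1)t) X - e F] is nonpositive outside a finite set, because [X] is
    bounded and [F] is large there.  If it were positive somewhere, it would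
    attain a positive maximum over that finite set and the time interval, at a
    positive time; there its time derivative would be nonnegative, while the
    equation, the discrete maximum principle and [Q F <= C F] make it
    negative. *)
Lemma flow_comparison X (B e : R) : backward_flow Q X -> 0 < e ->
  (forall (t : R) x, 0 <= t -> X t x <= B) -> (forall x, X 0 x <= e * F x) ->
  forall (t : R) x, 0 <= t -> X t x <= e * expR ((C + 1) * t) * F x.
Proof.
case: lyapF => C0 F0 finF QF [dX X0] e0 XB XF t x t0.
have [//|hx] := leP (X t x) _; exfalso.
have {t0} t0 : 0 < t.
  rewrite lt_neqAle t0 andbT; apply: contraTneq hx => <-.
  by rewrite mulr0 expR0 mulr1 -leNgt.
pose c := C + 1; pose E (s : R) : R := expR (- c * s).
pose h (s : R) y : R := E s * X s y - e * F y.
have E0 s : 0 < E s by exact: expR_gt0.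
have B0 : 0 <= B.
  apply: ltW; apply: lt_le_trans (XB t x (ltW t0)); apply: le_lt_trans hx.
  by rewrite !mulr_ge0 ?expR_ge0 // ltW.
have EK s : E s * expR (c * s) = 1 by rewrite /E -expRD mulNr addNr expR0.
have htx : 0 < h t x.
  have -> : h t x = E t * (X t x - e * expR (c * t) * F x).
    by rewrite /h; transitivity (E t * X t x - e * F x * (E t * expR (c * t)));
      [rewrite EK mulr1|ring].
  by rewrite mulr_gt0 // subr_gt0.
have dh (s : R) y : 0 < s ->
    is_derive s (1 : R) (h ^~ y) (E s * (act Q (X s) y - c * X s y)).
  move=> s0; have dXs := dX s y s0.
  have dE : is_derive s (1 : R) E (expR (- c * s) * - c).
    apply: is_derive1_comp; rewrite -[X in is_derive _ _ _ X]mulr1.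
    exact: is_deriveZ.
  have D := is_deriveB (is_deriveM dE dXs) (is_derive_cst (e * F y) s 1).
  apply: (is_derive_eq D).
  rewrite -/(E s) subr0 -![_ *: _]/(_ * _); ring.
have hE (s : R) : 0 <= s -> E s <= 1.
  by move=> s0; rewrite -expR0 ler_expR mulNr oppr_le0 mulr_ge0 // addr_ge0.
have h0le y : h 0 y <= 0.
  by rewrite /h /E mulr0 expR0 mul1r subr_le0.
have /finite_seqP[K KE] := finF (B / e).
have hK (s : R) y : 0 <= s -> 0 < h s y -> y \in K.
  move=> s0; rewrite subr_gt0 => hs.
  suff : [set y | F y <= B / e] y by rewrite KE.
  rewrite /= ler_pdivlMr // mulrC ltW //.
  apply: lt_le_trans hs _; apply: (@le_trans _ _ (E s * B)).
    by rewrite ler_wpM2l ?XB // ltW.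
  by rewrite ler_piMl // hE.
have cont y : {within `[0, t], continuous (h ^~ y)}.
  apply: derivable_oo_LRcontinuous_within; split.
  - by move=> s; rewrite in_itv /= => /andP[s0 _]; have [] := dh s y s0.
  - apply: cvgB; last exact: cvg_cst.
    apply: cvgM; last exact: X0.
    apply: cvg_at_right_filter; apply: continuous_comp; last exact: continuous_expR.
    exact: mulrl_continuous.
  - apply: cvg_at_left_filter.
    have [dht _] := dh t y t0.
    by have /derivable1_diffP/differentiable_continuous := dht.
have /choice[tm tmP] : forall y, exists s : R, s \in `[0, t] /\
    forall s', s' \in `[0, t] -> h s' y <= h s y.
  move=> y; have [s s1 s2] := EVT_max (ltW t0) (cont y); by exists s.
(* Maximize over time for each state, then over the finitely many states. *)
have [y yK ymax] := seq_argmax _ K (fun y => h (tm y) y) x (hK _ _ (ltW t0) htx).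
set s := tm y in ymax; have [sI smax] := tmP y.
have t_in : t \in `[0, t] by rewrite in_itv /= lexx ltW.
have hsy : 0 < h s y.
  apply: (lt_le_trans htx); apply: le_trans (ymax x (hK _ _ (ltW t0) htx)).
  by have [_ ->] := tmP x.
have {sI} /andP[s0 st] : 0 <= s <= t by move: sI; rewrite in_itv.
(* The maximum is positive, so it is not attained at time 0. *)
have {}s0 : 0 < s.
  by rewrite lt_neqAle s0 andbT; apply: contraTneq hsy => <-; rewrite -leNgt.
have hmax k : h s k <= h s y.
  have [hk|hk] := leP (h s k) 0; first exact: le_trans hk (ltW hsy).
  apply: le_trans (ymax k (hK _ _ (ltW s0) hk)).
  by have [_ ->] := tmP k => //; rewrite in_itv /= st ltW.
have : 0 <= E s * (act Q (X s) y - c * X s y).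
  apply: (left_max_derive (h ^~ y) s) => // [r /andP[r0 rs]|]; last exact: dh.
  by apply: smax; rewrite in_itv /= r0 (le_trans rs).
have XE k : E s * X s k = h s k + e * F k by rewrite /h subrK.
rewrite mulrBr mulrCA XE -actZ //.
have -> : (fun k => E s * X s k) = (fun k => h s k + e * F k) by apply: funext.
rewrite actD // actZ //.
have := act_le_max _ consQ _ _ hmax.
have : e * act Q F y <= e * (C * F y) by rewrite ler_wpM2l // ltW.
have : 0 <= e * F y by rewrite mulr_ge0 // ltW.
have : 0 <= C * h s y by rewrite mulr_ge0 // ltW.
move: hsy; rewrite /c; nra.
Qed.

End Comparison.

(** * Intertwining of minimal solutions *)

Lemma finite_uniq_seq (T : choiceType) (A : set T) : finite_set A ->
  exists K : seq T, uniq K /\ A = [set` K].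
Proof.
move=> /finite_seqP[s ->]; exists (undup s); rewrite undup_uniq; split=> //.
by apply/seteqP; split=> x /=; rewrite mem_undup.
Qed.

Section Intertwining.
Context {R : realType} {S T : countType}.
Variables (Q1 : S -> S -> R) (Q2 : T -> T -> R) (L : S -> T -> R).
Hypotheses (consQ1 : conservative Q1) (consQ2 : conservative Q2).
Hypotheses (finL : row_finite L) (L0 : forall x y, 0 <= L x y).
Variable B : R.
Hypothesis LB : forall x, act L (fun=> 1) x <= B.
Hypothesis QL : forall x y,
  act Q1 (fun x' => L x' y) x = act L (fun k => Q2 k y) x.

Let finQ1 : row_finite Q1. Proof. by case: consQ1. Qed.
Let finQ2 : row_finite Q2. Proof. by case: consQ2. Qed.

(** The entrywise identity [Q1 L = L Q2] extends to all functions because every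
    sum involved is finite. *)
Lemma act_intertwining g x :
  act Q1 (fun x' => act L g x') x = act L (fun k => act Q2 g k) x.
Proof.
have [r [ur hr]] := finQ1 x.
have /choice[rL hL] := finL; have /choice[rQ hQ] := finQ2.
have [uL0 hL0] := hL x.
(* A finite set of columns outside of which all rows that occur vanish. *)
pose W := undup (flatten [seq rL x' | x' <- r] ++ flatten [seq rQ k | k <- rL x]).
have uW : uniq W by exact: undup_uniq.
have LW x' : x' \in r -> forall y, y \notin W -> L x' y = 0.
  move=> x'r y; rewrite mem_undup mem_cat negb_or => /andP[yW _].
  have [_] := hL x'; apply; apply: contra yW => y_in.
  by apply/flattenP; exists (rL x') => //; apply/mapP; exists x'.
have QW k : k \in rL x -> forall y, y \notin W -> Q2 k y = 0.
  move=> x'r y; rewrite mem_undup mem_cat negb_or => /andP[_ yW].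
  have [_] := hQ k; apply; apply: contra yW => y_in.
  by apply/flattenP; exists (rQ k) => //; apply/mapP; exists k.
transitivity (\sum_(y <- W) act Q1 (fun x' => L x' y) x * g y).
  rewrite (actE _ _ _ ur hr) big_seq_cond.
  under eq_bigr => x' /andP[x'r _].
    rewrite (actE _ _ _ uW (LW _ x'r)) big_distrr /=; over.
  rewrite -big_seq_cond exchange_big /=; apply: eq_bigr => y _.
  rewrite (actE _ _ _ ur hr) big_distrl /=.
  by apply: eq_bigr => x' _; rewrite mulrA.
rewrite (actE _ _ _ uL0 hL0) [RHS]big_seq_cond.
under [RHS]eq_bigr => k /andP[kr _].
  rewrite (actE _ _ _ uW (QW _ kr)) big_distrr /=; over.
rewrite -big_seq_cond exchange_big /=; apply: eq_bigr => y _.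
rewrite QL (actE _ _ _ uL0 hL0) big_distrl /=.
by apply: eq_bigr => k _; rewrite mulrA.
Qed.

Lemma kernel_entry_le x y : L x y <= B.
Proof.
apply: le_trans (LB x); have [r [ur hr]] := finL x; rewrite (actE _ _ _ ur hr).
under eq_bigr do rewrite mulr1.
have [yr|/hr ->] := boolP (y \in r); last exact: sumr_ge0.
by rewrite (bigD1_seq y) //= lerDl sumr_ge0.
Qed.

Variables (P1 : R -> S -> S -> R) (P2 : R -> T -> T -> R).
Hypotheses (minP1 : minimal_backward_solution Q1 P1)
           (minP2 : minimal_backward_solution Q2 P2).
Variables (F : S -> R) (C : R).
Hypothesis lyapF : lyapunov Q1 F C.

Lemma mixture_flow y : backward_flow Q1 (fun t x => act L (fun k => P2 t k y) x).
Proof.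
have [dP P0] := nonneg_solution_flow Q2 P2 y minP2.1.
split=> [t x t0|x]; have [r [ur hr]] := finL x.
  rewrite act_intertwining (actE _ _ _ ur hr).
  under eq_fun do rewrite (actE _ _ _ ur hr).
  by apply: is_derive_lincomb => k; exact: dP.
rewrite (actE _ _ _ ur hr); under eq_fun do rewrite (actE _ _ _ ur hr).
by apply: cvg_lincomb.
Qed.

Lemma truncated_flow (K : seq S) (c : S -> R) :
  backward_flow Q1 (fun t x => \sum_(k <- K) c k * P1 t x k).
Proof.
have dP k := nonneg_solution_flow Q1 P1 k minP1.1.
split=> [t x t0|x].
  rewrite act_sum //; under eq_bigr do rewrite actZ //.
  by apply: is_derive_lincomb => k; apply (dP k).1.
by apply: cvg_lincomb => k; exact: (dP k).2.
Qed.

Lemma flowB X Y : backward_flow Q1 X -> backward_flow Q1 Y ->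
  backward_flow Q1 (fun t x => X t x - Y t x).
Proof.
move=> [dX X0] [dY Y0]; split=> [t x t0|x]; last exact: cvgB.
by rewrite actB //; apply: is_deriveB; [exact: dX|exact: dY].
Qed.

(** With [Y] the finite mixture on the right and [u K] the sum on the left
    restricted to a finite set [K] of states: [u K - Y] starts nonpositive, hence
    stays so; and when [K] is the level set [F <= B / d], the difference
    [Y - u K] starts below [d F], hence stays below a multiple of [d F]. *)
Theorem minimal_solution_intertwining t x y : 0 <= t ->
  kernel_mul (P1 t) L x y = kernel_mul L (P2 t) x y.
Proof.
move=> t0; have [[P1ge0 P1_0 _ _] _] := minP1; have [[P2ge0 P2_0 _ _] _] := minP2.
have P1le1 := minimal_solution_le1 _ consQ1 _ minP1.
have P2le1 := minimal_solution_le1 _ consQ2 _ minP2.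
pose Y (s : R) x := act L (fun k => P2 s k y) x.
have YB (s : R) x' : 0 <= s -> Y s x' <= B.
  move=> s0; apply: le_trans (LB x'); have [r [ur hr]] := finL x'.
  rewrite /Y !(actE _ _ _ ur hr); apply: ler_sum => k _.
  by rewrite ler_wpM2l // P2le1.
have Y0 x' : Y 0 x' = L x' y.
  have [r [ur hr]] := finL x'; rewrite /Y (actE _ _ _ ur hr).
  under eq_bigr do rewrite P2_0.
  have [yr|yr] := boolP (y \in r).
    rewrite (bigD1_seq y) //= eqxx mulr1 big1 ?addr0 // => k ky.
    by rewrite (negbTE ky) mulr0.
  rewrite hr // big_seq_cond big1 // => k /andP[kr _].
  by case: eqP => [ky|]; rewrite ?mulr0 //; rewrite -ky kr in yr.
have -> : kernel_mul L (P2 t) x y = (Y t x)%:E.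
  have [r [ur hr]] := finL x; rewrite /kernel_mul /Y (actE _ _ _ ur hr).
  transitivity (\esum_(k in [set` r]) (L x k * P2 t k y)%:E)%E.
    rewrite [RHS]esum_mkcond; apply: eq_esum => k _.
    by rewrite mem_setE; case: ifPn => // /hr ->; rewrite mul0r.
  rewrite esum_fset; last 1 first.
  - by move=> k _; rewrite lee_fin mulr_ge0 // P2ge0.
  - by rewrite -fsbig_seq // sumEFin.
  - exact: finite_seq.
(* The factor by which the comparison multiplies the initial bound. *)
pose c : R := expR ((C + 1) * t) * F x.
have [C0 F0 finF QF] := lyapF.
have c0 : 0 <= c by rewrite mulr_ge0 // expR_ge0.
pose u (K : seq S) (s : R) x' := \sum_(k <- K) L k y * P1 s x' k.
have u0 (K : seq S) x' : uniq K -> u K 0 x' = if x' \in K then L x' y else 0.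
  move=> uK; rewrite /u; under eq_bigr do rewrite P1_0.
  case: ifPn => x'K.
    rewrite (bigD1_seq x') //= eqxx mulr1 big1 ?addr0 // => k kx'.
    by rewrite eq_sym (negbTE kx') mulr0.
  rewrite big_seq_cond big1 // => k /andP[kK _].
  by case: eqP => [ky|]; rewrite ?mulr0 //; rewrite ky kK in x'K.
have uE (K : seq S) : (\sum_(k <- K) (P1 t x k * L k y)%:E = (u K t x)%:E)%E.
  by rewrite sumEFin; congr _%:E; apply: eq_bigr => k _; rewrite mulrC.
have flowY := mixture_flow y; have flowu K := truncated_flow K (fun k => L k y).
apply/eqP; rewrite eq_le; apply/andP; split.
  apply: ub_ereal_sup => _ [A [finA _] <-].
  have [K [uK ->]] := finite_uniq_seq _ _ finA.
  rewrite -fsbig_seq // uE lee_fin.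
  apply/ler_addgt0Pr => e e0; rewrite -lerBlDl.
  pose d := e / (c + 1); have d0 : 0 < d by rewrite divr_gt0 // ltr_wpDl.
  apply: (@le_trans _ _ (d * c)); last first.
    by rewrite /d mulrAC ler_pdivrMr ?ltr_wpDl // ler_wpM2l ?lerDl ?ltW.
  rewrite /d /c mulrA.
  apply: (flow_comparison _ consQ1 _ _ lyapF _ (\sum_(k <- K) L k y) _
    (flowB _ _ (flowu K) flowY)) => // [s x' s0|x'].
    rewrite -[leRHS]subr0 lerB //.
      by apply: ler_sum => k _; rewrite ler_piMr // P1le1.
    have [r [ur hr]] := finL x'; rewrite (actE _ _ _ ur hr).
    by apply: sumr_ge0 => k _; rewrite mulr_ge0 // P2ge0.
  apply: (@le_trans _ _ 0); last by rewrite mulr_ge0 // ltW.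
  rewrite subr_le0 -/(u K 0 x') -/(Y 0 x') u0 // Y0.
  by case: ifP.
apply/lee_addgt0Pr => e e0.
pose d := e / (c + 1); have d0 : 0 < d by rewrite divr_gt0 // ltr_wpDl.
have finA := finF (B / d); set A := [set _ | _] in finA.
have [K [uK AK]] := finite_uniq_seq _ _ finA.
apply: (@le_trans _ _ ((u K t x)%:E + e%:E)%E); last first.
  rewrite leeD2r // -uE; apply: ereal_sup_ubound; exists A => //.
  by rewrite AK -fsbig_seq.
rewrite -EFinD lee_fin -lerBlDl.
apply: (@le_trans _ _ (d * c)); last first.
  by rewrite /d mulrAC ler_pdivrMr ?ltr_wpDl // ler_wpM2l ?lerDl ?ltW.
rewrite /d /c mulrA.
apply: (flow_comparison _ consQ1 _ _ lyapF _ B _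
  (flowB _ _ flowY (flowu K))) => // [s x' s0|x'].
  rewrite -[leRHS]subr0 lerB ?YB // /u.
  by apply: sumr_ge0 => k _; rewrite mulr_ge0 // P1ge0.
rewrite -/(u K 0 x') -/(Y 0 x') u0 // Y0.
case: ifPn => [_|]; first by rewrite subrr mulr_ge0 // ltW.
move=> x'K; rewrite subr0; have : ~ A x' by rewrite AK /=; exact/negP.
rewrite /A /= => /negP; rewrite -ltNge.
rewrite ltr_pdivrMr // mulrC => /ltW; apply: le_trans; exact: kernel_entry_le.
Qed.

End Intertwining.

(** * One-variable operators and determinants *)

Section OneVariable.
Context {R : comNzRingType} (a1 a0 b1 b0 : R).

Definition up_quad (x : R) := x ^+ 2 + a1 * x + a0.
Definition dn_quad (x : R) := x ^+ 2 + b1 * x + b0.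

Definition diff_op (g : R -> R) (x : R) :=
  up_quad x * (g (x + 1) - g x) + dn_quad x * (g (x - 1) - g x).

Definition diff_op_eigenvalue (k : nat) : R := k%:R * (k%:R - 1 + a1 - b1).

(** The two differences have opposite leading terms, so their sum does not raise
    the degree.  The induction follows the sum and the difference of the two
    weighted shifts of x^k as well: the three polynomials of order k+1 are
    combinations of those of order k with coefficients 1 and x. *)
Lemma diff_op_monomial k : exists p : {poly R},
  [/\ (size p <= k.+1)%N, p`_k = diff_op_eigenvalue k
    & forall x, p.[x] = diff_op (fun y => y ^+ k) x].
Proof.
suff [p [q [r [[sp cp ep] [sq cq eq] [sr cr er]]]]] : exists p q r : {poly R},
  [/\ [/\ (size p <= k.+1)%N, p`_k = diff_op_eigenvalue k
        & forall x, p.[x] = diff_op (fun y => y ^+ k) x],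
      [/\ (size q <= k.+2)%N, q`_k.+1 = a1 - b1 + 2 * k%:R
        & forall x, q.[x] = up_quad x * (x + 1) ^+ k - dn_quad x * (x - 1) ^+ k]
    & [/\ (size r <= k.+3)%N, r`_k.+2 = 2
        & forall x, r.[x] = up_quad x * (x + 1) ^+ k + dn_quad x * (x - 1) ^+ k]].
  by exists p.
elim: k => [|k [p [q [r [[sp cp ep] [sq cq eq] [sr cr er]]]]]].
  exists 0, (Poly [:: a0 - b0; a1 - b1]), (Poly [:: a0 + b0; a1 + b1; 2]).
  split; split; rewrite ?size_poly0 ?coef0 ?(leq_trans (size_Poly _)) //.
  - by rewrite /diff_op_eigenvalue mul0r.
  - by move=> x; rewrite horner0 /diff_op !expr0 !subrr !mulr0 addr0.
  - by rewrite coef_Poly /= mulr0 addr0.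
  - by move=> x; rewrite horner_Poly /= /up_quad /dn_quad !expr0; ring.
  - by rewrite coef_Poly.
  - by move=> x; rewrite horner_Poly /= /up_quad /dn_quad !expr0; ring.
have sX (s : {poly R}) m : (size s <= m)%N -> (size (s * 'X)%R <= m.+1)%N.
  by move=> sm; apply: leq_trans (size_polyMleq _ _) _; rewrite size_polyX addn2.
have sD (s t : {poly R}) m : (size s <= m)%N -> (size t <= m)%N ->
    (size (s + t)%R <= m)%N.
  by move=> h1 h2; apply: leq_trans (size_polyD _ _) _; rewrite geq_max h1.
exists (p * 'X + q), (q * 'X + r), (r * 'X + q); split; split.
- by apply: sD => //; exact: sX.
- by rewrite coefD coefMX /= cp cq /diff_op_eigenvalue -natr1; ring.
- by move=> x; rewrite hornerD hornerMX ep eq /diff_op !exprS; ring.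
- by apply: sD => //; exact: sX.
- by rewrite coefD coefMX /= cr cq -natr1; ring.
- by move=> x; rewrite hornerD hornerMX er eq !exprS; ring.
- by apply: sD; [exact: sX|apply: (leq_trans sq); rewrite leqW].
- by rewrite coefD coefMX /= cr (nth_default 0 (leqW sq)) addr0.
- by move=> x; rewrite hornerD hornerMX er eq !exprS; ring.
Qed.

End OneVariable.

Section Vandermonde.
Context {R : comNzRingType}.

Definition shift {V : zmodType} {N} (l : 'I_N -> V) (i : 'I_N) (e : V) : 'I_N -> V :=
  fun j => l j + (if j == i then e else 0).

Definition vdm {N} (l : 'I_N -> R) : R :=
  \prod_(i < N) \prod_(j < N | (i < j)%N) (l i - l j).

(** The sign relating the two products depends on [N] only and cancels in every
    linear relation between values of [vdm]. *)
Lemma vdm_det N : exists s : R, forall l : 'I_N -> R,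
  vdm l = s * \det (\matrix_(i < N, j < N) l i ^+ j).
Proof.
exists (\prod_(i < N) \prod_(j < N | (i < j)%N) (-1)) => l.
have -> : \matrix_(i, j) l i ^+ j = (Vandermonde N (\row_i l i))^T.
  by apply/matrixP => i j; rewrite !mxE.
rewrite det_tr det_Vandermonde -big_split; apply: eq_bigr => i _ /=.
rewrite -big_split; apply: eq_bigr => j _ /=.
by rewrite !mxE mulN1r opprB.
Qed.

Lemma det_replace_row N (A B : 'M[R]_N) i : row' i A = row' i B ->
  \det B = \sum_j B i j * cofactor A i j.
Proof.
move=> AB; rewrite (expand_det_row B i); apply: eq_bigr => j _.
rewrite /cofactor; congr (_ * (_ * \det _)); apply/matrixP => k m.
by move/matrixP/(_ k (lift j m)): AB; rewrite !mxE.
Qed.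

(** This is the derivative of the determinant at [A] in the direction [A T], the
    Jacobi formula. *)
Lemma sum_cofactor_mulmx N (A T : 'M[R]_N) :
  \sum_i \sum_j (A *m T) i j * cofactor A i j = \tr T * \det A.
Proof.
have -> : \sum_i \sum_j (A *m T) i j * cofactor A i j = \tr (A *m T *m \adj A).
  by apply: eq_bigr => i _; rewrite [RHS]mxE; apply: eq_bigr => j _; rewrite [(\adj A) _ _]mxE.
by rewrite mxtrace_mulC mulmxA mul_adj_mx mul_scalar_mx mxtraceZ mulrC.
Qed.

End Vandermonde.

(** * The Vandermonde eigenrelation and the generator on symmetric functions *)

Section Eigenrelation.
Context {R : comNzRingType} (a1 a0 b1 b0 : R).

Definition multi_op {N} (f : ('I_N -> R) -> R) (l : 'I_N -> R) : R :=
  \sum_i (up_quad a1 a0 (l i) * (f (shift l i 1) - f l)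
          + dn_quad b1 b0 (l i) * (f (shift l i (-1)) - f l)).

Definition multi_eigenvalue (N : nat) : R :=
  \sum_(k < N) diff_op_eigenvalue a1 b1 k.

(** Applying the one-variable operators to one row at a time of the matrix of
    monomials amounts to differentiating its determinant in the direction
    [M T], where [T] is the triangular matrix of the operator on monomials; the
    result is the trace of [T] times the determinant. *)
Lemma vdm_eigen N (l : 'I_N -> R) : multi_op vdm l = multi_eigenvalue N * vdm l.
Proof.
have [s vE] := @vdm_det R N.
have /choice[p pP] := diff_op_monomial a1 a0 b1 b0.
pose M (m : 'I_N -> R) : 'M[R]_N := \matrix_(i, j) m i ^+ j.
pose T : 'M[R]_N := \matrix_(k, j) (p j)`_k.
have MT i (j : 'I_N) : (M l *m T) i j = (p j).[l i].
  have [sp _ _] := pP j.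
  rewrite mxE (horner_coef_wide _ (leq_trans sp (ltn_ord j))).
  by apply: eq_bigr => k _; rewrite !mxE mulrC.
have Mdet m i : row' i (M m) = row' i (M l) ->
    \det (M m) = \sum_(j < N) m i ^+ j * cofactor (M l) i j.
  move=> Mm; rewrite (det_replace_row _ (M l) (M m) i) //.
  by apply: eq_bigr => j _; rewrite mxE.
have rowM i e : row' i (M (shift l i e)) = row' i (M l).
  apply/matrixP => k j; rewrite !mxE /shift.
  by rewrite eq_sym (negbTE (neq_lift _ _)) addr0.
have -> : multi_op vdm l = s * \sum_i \sum_j (M l *m T) i j * cofactor (M l) i j.
  rewrite /multi_op big_distrr; apply: eq_bigr => i _ /=.
  rewrite !vE -/(M _) -/(M _) -/(M _) (Mdet _ i (rowM i 1)).
  rewrite (Mdet _ i (rowM i (-1))) (Mdet l i erefl) -!mulrBr -!sumrB.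
  rewrite mulrCA [X in _ + X]mulrCA -mulrDr; congr (_ * _).
  rewrite !big_distrr -big_split /=; apply: eq_bigr => j _; rewrite MT.
  have [_ _ ->] := pP j; rewrite /diff_op /shift !eqxx; ring.
rewrite sum_cofactor_mulmx vE mulrCA; congr (_ * _); apply: eq_bigr => k _.
by rewrite mxE; have [_ ->] := pP k.
Qed.

Definition cons_fun {V : Type} {N} (y : V) (l : 'I_N -> V) : 'I_N.+1 -> V :=
  fun i => oapp l y (unlift ord0 i).

Lemma vdm_cons N y (l : 'I_N -> R) :
  vdm (cons_fun y l) = \prod_j (y - l j) * vdm l.
Proof.
have lift0 (j : 'I_N) : cons_fun y l (lift ord0 j) = l j.
  by rewrite /cons_fun liftK.
rewrite /vdm big_ord_recl; congr (_ * _).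
  rewrite big_mkcond big_ord_recl /= mul1r; apply: eq_bigr => j _.
  by rewrite lift0 /cons_fun unlift_none.
apply: eq_bigr => i _; rewrite big_mkcond big_ord_recl /= mul1r [RHS]big_mkcond.
by apply: eq_bigr => j _; rewrite !lift0.
Qed.

Lemma shift_cons_head N y (l : 'I_N -> R) e :
  shift (cons_fun y l) ord0 e = cons_fun (y + e) l.
Proof.
apply: funext => j; rewrite /shift /cons_fun.
case: unliftP => [k ->|->] //=.
by rewrite addr0.
Qed.

Lemma shift_cons_tail N y (l : 'I_N -> R) i e :
  shift (cons_fun y l) (lift ord0 i) e = cons_fun y (shift l i e).
Proof.
apply: funext => j; rewrite /shift /cons_fun.
case: unliftP => [k ->|->] /=; first by rewrite (inj_eq lift_inj).
by rewrite addr0.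
Qed.

(** The Vandermonde product in N+1 variables is the one in N variables times the
    polynomial with roots [l], so the eigenrelation in N+1 variables trades the
    action on the roots for the action on the free variable [y]. *)
Lemma multi_op_dual N y (l : 'I_N -> R) :
  multi_op (fun m => \prod_j (y - m j) * vdm m) l =
  (multi_eigenvalue N.+1 * \prod_j (y - l j)
   - diff_op a1 a0 b1 b0 (fun x => \prod_j (x - l j)) y) * vdm l.
Proof.
have := vdm_eigen _ (cons_fun y l).
rewrite {1}/multi_op big_ord_recl !shift_cons_head !vdm_cons.
have -> : cons_fun y l ord0 = y by rewrite /cons_fun unlift_none.
rewrite [X in _ + X](_ : _ = multi_op (fun m => \prod_j (y - m j) * vdm m) l).
  move=> E; rewrite mulrBl -mulrA -E /diff_op; ring.
apply: eq_bigr => i _; rewrite !shift_cons_tail !vdm_cons.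
by rewrite /cons_fun liftK.
Qed.

End Eigenrelation.

Section Generator.
Context {R : numFieldType} (a1 a0 b1 b0 : R).

Definition up_weight {N} (l : 'I_N -> R) i :=
  up_quad a1 a0 (l i) * (vdm (shift l i 1) / vdm l).
Definition dn_weight {N} (l : 'I_N -> R) i :=
  dn_quad b1 b0 (l i) * (vdm (shift l i (-1)) / vdm l).

Definition gen {N} (f : ('I_N -> R) -> R) (l : 'I_N -> R) : R :=
  \sum_i (up_weight l i * (f (shift l i 1) - f l)
          + dn_weight l i * (f (shift l i (-1)) - f l)).

(** The Doob transform: [gen] is the conjugate of [multi_op] by [vdm], shifted
    by the eigenvalue. *)
Lemma genE N (f : ('I_N -> R) -> R) l : vdm l != 0 ->
  gen f l = multi_op a1 a0 b1 b0 (fun m => f m * vdm m) l / vdm l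
            - multi_eigenvalue a1 b1 N * f l.
Proof.
move=> v0; have /(canRL (mulfK v0)) -> := esym (vdm_eigen a1 a0 b1 b0 N l).
rewrite mulrAC -mulrBl /multi_op big_distrl /= -sumrB big_distrl.
by apply: eq_bigr => i _; rewrite /= /up_weight /dn_weight; field.
Qed.

Lemma gen_dual N y (l : 'I_N -> R) : vdm l != 0 ->
  gen (fun m => \prod_j (y - m j)) l =
  (multi_eigenvalue a1 b1 N.+1 - multi_eigenvalue a1 b1 N) * \prod_j (y - l j)
  - diff_op a1 a0 b1 b0 (fun x => \prod_j (x - l j)) y.
Proof. by move=> v0; rewrite genE // multi_op_dual mulfK //; ring. Qed.

Lemma total_weight N (l : 'I_N -> R) : vdm l != 0 ->
  \sum_i (up_weight l i + dn_weight l i) =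
  \sum_i (up_quad a1 a0 (l i) + dn_quad b1 b0 (l i)) + multi_eigenvalue a1 b1 N.
Proof.
move=> v0; have /(canRL (mulfK v0)) -> := esym (vdm_eigen a1 a0 b1 b0 N l).
rewrite /multi_op big_distrl /= -big_split; apply: eq_bigr => i _ /=.
by rewrite /up_weight /dn_weight; field.
Qed.

Definition root_poly {N} (l : 'I_N -> R) : {poly R} := \prod_j ('X - (l j)%:P).

Lemma poly_horner_inj (p q : {poly R}) : (forall x, p.[x] = q.[x]) -> p = q.
Proof.
move=> pq; apply/eqP; rewrite -subr_eq0; apply/eqP.
apply: (@roots_geq_poly_eq0 _ _ [seq i%:R | i <- iota 0 (size (p - q)%R)]).
- by apply/allP => x _; rewrite rootE hornerD hornerN pq subrr.
- rewrite map_inj_uniq ?iota_uniq // => i j /eqP.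
  by rewrite eqr_nat => /eqP.
- by rewrite size_map size_iota.
Qed.

Lemma size_root_poly N (l : 'I_N -> R) : size (root_poly l) = N.+1.
Proof. by rewrite /root_poly -big_enum size_prod_XsubC size_enum_ord. Qed.

Lemma horner_root_poly N (l : 'I_N -> R) y : (root_poly l).[y] = \prod_j (y - l j).
Proof. by rewrite horner_prod; apply: eq_bigr => j _; rewrite hornerXsubC. Qed.

(** Comparing coefficients in the duality: the one-variable operator does not
    raise degrees, so the coefficient of degree [k] is mapped to a combination of
    coefficients of degree at least [k]. *)
Lemma gen_root_poly_coef N k : (k <= N)%N -> exists T : nat -> R,
  forall l : 'I_N -> R, vdm l != 0 ->
  gen (fun m => (root_poly m)`_k) l = \sum_(k <= j < N.+1) T j * (root_poly l)`_j.
Proof.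
move=> kN; have /choice[p pP] := diff_op_monomial a1 a0 b1 b0.
pose c := multi_eigenvalue a1 b1 N.+1 - multi_eigenvalue a1 b1 N.
exists (fun j => (if j == k then c else 0) - (p j)`_k) => l v0.
(* The duality holds at every point y, hence between polynomials in y. *)
pose r := root_poly l; pose r1 e i := root_poly (shift l i e).
have polyE : \sum_i (up_weight l i *: (r1 1 i - r) + dn_weight l i *: (r1 (-1) i - r))
    = c *: r - \sum_(j < N.+1) r`_j *: p j.
  apply: poly_horner_inj => y; rewrite hornerD hornerN hornerZ !horner_sum.
  transitivity (gen (fun m => \prod_j (y - m j)) l).
    apply: eq_bigr => i _.
    by rewrite hornerD !hornerZ !(hornerD, hornerN) !horner_root_poly.
  rewrite gen_dual // horner_root_poly -/c; congr (_ - _).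
  have rE x : \prod_j (x - l j) = \sum_(j < N.+1) r`_j * x ^+ j.
    by rewrite -horner_root_poly (@horner_coef_wide _ N.+1) ?size_root_poly.
  rewrite /diff_op !rE -!sumrB !big_distrr -big_split; apply: eq_bigr => j _ /=.
  by rewrite hornerZ; have [_ _ ->] := pP j; rewrite /diff_op; ring.
have -> : gen (fun m => (root_poly m)`_k) l = (c *: r - \sum_(j < N.+1) r`_j *: p j)`_k.
  rewrite -polyE coef_sum; apply: eq_bigr => i _.
  by rewrite coefD !coefZ !coefB.
rewrite coefB coefZ coef_sum -(big_mkord xpredT (fun j => (r`_j *: p j)`_k)).
rewrite (@big_cat_nat _ _ _ k) //= ?leqW // big_nat_cond big1 ?add0r; last first.
  move=> j /andP[/andP[_ jk] _]; have [sp _ _] := pP j.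
  by rewrite coefZ [(p j)`_k]nth_default ?mulr0 // (leq_trans sp).
under [RHS]eq_bigr do rewrite mulrBl.
rewrite sumrB; congr (_ - _); last by apply: eq_bigr => j _; rewrite coefZ mulrC.
rewrite big_ltn ?ltnS // eqxx big_nat_cond big1 ?addr0 // => j /andP[/andP[kj _] _].
by rewrite gtn_eqF // mul0r.
Qed.

(** The Newton identity p_2 = e_1^2 - 2 e_2 for the roots. *)
Lemma root_poly_coefs N (l : 'I_N.+2 -> R) :
  [/\ (root_poly l)`_N.+2 = 1, (root_poly l)`_N.+1 = - \sum_i l i
    & \sum_i l i ^+ 2 = (root_poly l)`_N.+1 ^+ 2 - 2 * (root_poly l)`_N].
Proof.
have lead n (m : 'I_n -> R) : (root_poly m)`_n = 1.
  have := monic_prod_XsubC (enum 'I_n) xpredT m; rewrite big_enum -/(root_poly m).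
  by rewrite monicE lead_coefE size_root_poly => /eqP.
have recl n (m : 'I_n.+1 -> R) :
    root_poly m = ('X - (m ord0)%:P) * root_poly (fun i => m (lift ord0 i)).
  by rewrite /root_poly big_ord_recl.
have coefr n (m : 'I_n.+1 -> R) k : (root_poly m)`_k.+1 =
    (root_poly (fun i => m (lift ord0 i)))`_k
    - m ord0 * (root_poly (fun i => m (lift ord0 i)))`_k.+1.
  by rewrite recl mulrBl coefB coefXM coefCM.
have sum n (m : 'I_n.+1 -> R) : (root_poly m)`_n = - \sum_i m i.
  elim: n m => [|n IH] m.
    rewrite recl mulrBl coefB coefXM coefCM /= lead mulr1 sub0r.
    by rewrite big_ord_recl big_ord0 addr0.
  by rewrite coefr IH lead mulr1 [in RHS]big_ord_recl opprD addrC.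
split=> //; elim: N l => [|n IH] l.
  rewrite sum recl mulrBl coefB coefXM coefCM /= sum.
  by rewrite !(big_ord_recl, big_ord0) /=; ring.
by rewrite big_ord_recl IH !(coefr _ l) lead; ring.
Qed.

End Generator.

(** * The quadratic Lyapunov function *)

Section QuadraticLyapunov.
Context {R : realFieldType} (a1 a0 b1 b0 : R).

Definition quad_energy {N} (l : 'I_N -> R) : R := 1 + \sum_i l i ^+ 2.

Lemma quad_energy_ge1 N (l : 'I_N -> R) : 1 <= quad_energy l.
Proof. by rewrite lerDl sumr_ge0 // => i _; rewrite sqr_ge0. Qed.

Lemma sqr_sum_le N (l : 'I_N -> R) : (\sum_i l i) ^+ 2 <= 2 ^+ N * \sum_i l i ^+ 2.
Proof.
elim: N l => [|N IH] l; first by rewrite !big_ord0 expr0n mulr0.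
rewrite !big_ord_recl [2 ^+ N.+1]exprS; have := IH (fun i => l (lift ord0 i)) => /=.
set s := \sum_i _; set p := \sum_i _; set K := 2 ^+ N => sp.
have K1 : 1 <= K by rewrite exprn_ege1 // ler1n.
have : l ord0 ^+ 2 <= K * l ord0 ^+ 2 by rewrite ler_peMl // sqr_ge0.
have -> : (l ord0 + s) ^+ 2 = 2 * l ord0 ^+ 2 + 2 * s ^+ 2 - (l ord0 - s) ^+ 2 by ring.
have := sqr_ge0 (l ord0 - s); rewrite -mulrA mulrDr; lra.
Qed.

Lemma total_weight_le N : exists K : R, 0 <= K /\ forall l : 'I_N -> R, vdm l != 0 ->
  \sum_i (up_weight a1 a0 l i + dn_weight b1 b0 l i) <= K * quad_energy l.
Proof.
pose c := multi_eigenvalue a1 b1 N; pose A := `|a1 + b1|; pose B := `|a0 + b0|.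
have A0 : 0 <= A := normr_ge0 _; have B0 : 0 <= B := normr_ge0 _.
have c0 : 0 <= `|c| := normr_ge0 _.
exists (2 + A + N%:R * (A + B) + `|c|); split.
  by rewrite !addr_ge0 // mulr_ge0 // addr_ge0.
move=> l v0; rewrite total_weight // -/c.
apply: (@le_trans _ _ (\sum_i ((2 + A) * l i ^+ 2 + (A + B)) + `|c|)).
  apply: lerD; last exact: ler_norm.
  apply: ler_sum => i _; rewrite /up_quad /dn_quad.
  have : (a1 + b1) * l i <= A * `|l i| by rewrite -normrM ler_norm.
  have : A * `|l i| <= A * (1 + l i ^+ 2).
    rewrite ler_wpM2l // -[l i ^+ 2]ger0_norm ?sqr_ge0 // normrX.
    have := sqr_ge0 (`|l i| - 1); have := normr_ge0 (l i); nra.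
  have : a0 + b0 <= B := ler_norm _.
  by lra.
rewrite big_split /= -mulr_sumr sumr_const card_ord -[(A + B) *+ N]mulr_natl.
have F1 := quad_energy_ge1 _ l; rewrite /quad_energy in F1 *.
set p := \sum_i _ in F1 *.
have p0 : 0 <= p by rewrite lerDl in F1.
have N0 : 0 <= N%:R * (A + B) by rewrite mulr_ge0 // addr_ge0.
nra.
Qed.

(** With e_1, e_2 the elementary symmetric functions, F = 1 + e_1^2 - 2 e_2.
    The generator maps e_1 and e_2 to combinations of e_1, e_2 and 1.  A jump
    changes e_1 by 1 or -1, so the square contributes, besides
    2 e_1 gen(e_1), the total jump rate, which is quadratic in [l].  All
    these terms are bounded by multiples of F. *)
Lemma quad_energy_lyapunov N : exists C : R, 0 <= C /\
  forall l : 'I_N.+2 -> R, vdm l != 0 ->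
  gen a1 a0 b1 b0 quad_energy l <= C * quad_energy l.
Proof.
have [T1 T1P] := gen_root_poly_coef a1 a0 b1 b0 N.+2 N.+1 (leqnSn _).
have [T0 T0P] := gen_root_poly_coef a1 a0 b1 b0 N.+2 N (leqW (leqnSn _)).
have [K [K0 totK]] := total_weight_le N.+2.
pose f1 (m : 'I_N.+2 -> R) := (root_poly m)`_N.+1.
pose f0 (m : 'I_N.+2 -> R) := (root_poly m)`_N.
have FE m : quad_energy m = 1 + f1 m ^+ 2 - 2 * f0 m.
  by rewrite /quad_energy; have [_ _ ->] := root_poly_coefs N m; rewrite addrA.
have f1S m i e : f1 (shift m i e) = f1 m - e.
  rewrite /f1; have [_ -> _] := root_poly_coefs N (shift m i e).
  have [_ -> _] := root_poly_coefs N m.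
  rewrite /shift big_split /= -big_mkcond big_pred1_eq; ring.
have genF m : gen a1 a0 b1 b0 quad_energy m =
    2 * f1 m * gen a1 a0 b1 b0 f1 m - 2 * gen a1 a0 b1 b0 f0 m
    + \sum_i (up_weight a1 a0 m i + dn_weight b1 b0 m i).
  rewrite /gen !mulr_sumr -sumrB -big_split; apply: eq_bigr => i _ /=.
  by rewrite !FE !f1S; ring.
have [K2 [K20 sumK2]] : exists K2 : R, 0 <= K2 /\
    forall m : 'I_N.+2 -> R, (\sum_i m i) ^+ 2 <= K2 * \sum_i m i ^+ 2.
  by exists (2 ^+ N.+2); split; [rewrite exprn_ge0|exact: sqr_sum_le].
have K21 : 0 <= 1 + K2 by rewrite addr_ge0.
exists (2 * `|T1 N.+1| * K2 + 2 * `|T1 N.+2| * (1 + K2) + 2 * `|T0 N| * (1 + K2)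
  + 2 * `|T0 N.+1| * (1 + K2) + 2 * `|T0 N.+2| + K); split.
  by rewrite !addr_ge0 // !mulr_ge0.
move=> l v0; rewrite genF; have {}totK := totK l v0.
have {}T1P : gen a1 a0 b1 b0 f1 l = T1 N.+1 * f1 l + T1 N.+2.
  rewrite T1P // big_ltn // big_nat1; have [-> _ _] := root_poly_coefs N l.
  by rewrite mulr1.
have {}T0P : gen a1 a0 b1 b0 f0 l = T0 N * f0 l + T0 N.+1 * f1 l + T0 N.+2.
  rewrite T0P // big_ltn 1?ltnS ?leqW // big_ltn // big_nat1.
  by have [-> _ _] := root_poly_coefs N l; rewrite mulr1 addrA.
rewrite T1P T0P; have F1 := quad_energy_ge1 _ l.
have FEl := FE l; set F := quad_energy l in F1 FEl totK *.
have f1K : f1 l ^+ 2 <= K2 * F.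
  rewrite /f1; have [_ -> _] := root_poly_coefs N l; rewrite sqrrN.
  apply: le_trans (sumK2 _) _; rewrite ler_wpM2l // /F lerDr //.
have f1A : `|f1 l| <= (1 + K2) * F.
  apply: (@le_trans _ _ (1 + f1 l ^+ 2)); last by lra.
  rewrite -[f1 l ^+ 2]ger0_norm ?sqr_ge0 // normrX.
  have := sqr_ge0 (`|f1 l| - 1); have := normr_ge0 (f1 l); nra.
have f0A : `|f0 l| <= (1 + K2) * F.
  rewrite ler_norml; have := sqr_ge0 (f1 l).
  have : 0 <= K2 * F by rewrite mulr_ge0 // (le_trans _ F1).
  by move=> h1 h2; apply/andP; split; lra.
have bnd (a x M : R) : `|x| <= M -> a * x <= `|a| * M.
  move=> xM; apply: le_trans (ler_norm _) _; rewrite normrM.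
  by rewrite ler_wpM2l.
have h1 := bnd (T1 N.+1) (f1 l ^+ 2) (K2 * F).
rewrite (ger0_norm (sqr_ge0 _)) in h1; have {}h1 := h1 f1K.
have h2 := bnd (T1 N.+2) _ _ f1A.
have h3 := bnd (- T0 N) _ _ f0A.
have h4 := bnd (- T0 N.+1) _ _ f1A.
have h5 : - T0 N.+2 <= `|T0 N.+2| * F.
  apply: le_trans (ler_norm _) _; rewrite normrN.
  by rewrite ler_peMr.
rewrite !normrN in h3 h4.
have -> : 2 * f1 l * (T1 N.+1 * f1 l + T1 N.+2) =
  2 * (T1 N.+1 * f1 l ^+ 2) + 2 * (T1 N.+2 * f1 l) by ring.
rewrite !mulrDl -!mulrA; lra.
Qed.

End QuadraticLyapunov.

(** * The exchange identity for interlacing coordinates *)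

Section VandermondeRatio.
Context {R : fieldType}.

Lemma vdm_shift_ratio N (l : 'I_N -> R) i e : vdm l != 0 ->
  vdm (shift l i e) / vdm l = \prod_(j < N | j != i) ((l i + e - l j) / (l i - l j)).
Proof.
move=> v0.
have lij (a b : 'I_N) : (a < b)%N -> l a - l b != 0.
  move=> ab; move: v0; rewrite /vdm (bigD1 a) //= (bigD1 b) //= !mulf_eq0.
  by rewrite !negb_or => /andP[/andP[]].
pose rho j := (l i + e - l j) / (l i - l j).
rewrite /vdm -prodf_div.
transitivity (\prod_(a < N) \prod_(b < N | (a < b)%N)
    ((if a == i then rho b else 1) * (if b == i then rho a else 1))).
  apply: eq_bigr => a _; rewrite -prodf_div; apply: eq_bigr => b ab.
  rewrite /shift /rho.
  have [ai|ai] := eqVneq a i.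
    have bi : (b == i) = false by apply/negbTE; rewrite -ai neq_ltn ab orbT.
    by rewrite bi addr0 mulr1 ai.
  have [bi|bi] := eqVneq b i; last by rewrite !addr0 divff ?lij // mulr1.
  rewrite addr0 mul1r -bi -[RHS]mulrNN -invrN !opprB.
  by congr (_ / _); ring.
under eq_bigr do rewrite big_split.
rewrite big_split /=; under [X in _ * X]eq_bigr do rewrite -big_mkcondr.
rewrite [X in X * _](bigD1 i) //= [X in _ * X * _]big1 ?mulr1; last first.
  by move=> a /negbTE ->; rewrite big1.
rewrite eqxx [RHS](bigID (fun j : 'I_N => (i < j)%N)) /=; congr (_ * _).
  by apply: eq_bigl => j; rewrite neq_ltn; case: ltngtP.
rewrite [RHS]big_mkcond; apply: eq_bigr => a _.
have -> : (a != i) && ~~ (i < a)%N = (a < i)%N by rewrite neq_ltn; case: ltngtP.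
have [ai|ai] := ifP; last first.
  by rewrite big1 // => b /andP[ab /eqP bi]; rewrite bi ai in ab.
by rewrite (big_pred1 i) // => b /=; case: eqP => [->|]; rewrite ?ai ?andbF.
Qed.

End VandermondeRatio.

Section Perturbation.
Context {R : comNzRingType}.

(** Only the terms of first order survive in the expansion. *)
Lemma prod_perturb (I : finType) (x d : I -> R) :
  (forall i j, i != j -> d i * d j = 0) ->
  \prod_i (x i + d i) = \prod_i x i + \sum_i d i * \prod_(j | j != i) x j.
Proof.
move=> dd.
suff H (r : seq I) : uniq r -> \prod_(i <- r) (x i + d i) =
    \prod_(i <- r) x i + \sum_(i <- r) d i * \prod_(j <- r | j != i) x j.
  by rewrite H // index_enum_uniq.
elim: r => [|a r IH] /=; first by rewrite !big_nil addr0.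
move=> /andP[ar ur]; rewrite !big_cons IH // eqxx /=.
have ne j : j \in r -> (a != j) by move=> jr; apply: contraNneq ar => ->.
have -> : \prod_(j <- r | j != a) x j = \prod_(j <- r) x j.
  rewrite big_seq_cond [RHS]big_seq_cond; apply: eq_bigl => j.
  by case: (boolP (j \in r)) => //= /ne; rewrite eq_sym => ->.
have -> : \sum_(i <- r) d i * \prod_(j <- a :: r | j != i) x j =
    x a * \sum_(i <- r) d i * \prod_(j <- r | j != i) x j.
  rewrite big_distrr big_seq_cond [RHS]big_seq_cond; apply: eq_bigr => i /andP[ir _].
  by rewrite big_cons ne //= mulrCA.
have da : d a * \sum_(i <- r) d i * \prod_(j <- r | j != i) x j = 0.
  rewrite big_distrr big_seq_cond big1 // => i /andP[ir _].
  by rewrite /= mulrA dd ?mul0r // ne.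
by rewrite mulrDr mulrDl [X in _ + X]mulrDl da; ring.
Qed.

(** For nonincreasing [l], the indicator that [n k] lies between consecutive
    entries of [l]; the difference depends additively on each end point. *)
Definition slot {N} (l : 'I_N.+1 -> int) (n : 'I_N -> int) (k : 'I_N) : R :=
  (n k < l (widen_ord (leqnSn N) k))%R%:R - (n k < l (lift ord0 k))%R%:R.

Definition slots {N} (l : 'I_N.+1 -> int) (n : 'I_N -> int) : R :=
  \prod_k slot l n k.

(** Moving the coordinate [l i] changes the upper end of one interval and the
    lower end of the previous one; the product of both changes vanishes because
    the points [n k] are distinct.  Moving the point [n k] by the opposite amount
    changes the same factor [k] in the same way at both ends.  In either case a
    change is nonzero only when the point sits at the moving end, where the
    weights [w] and [w'] agree. *)
Lemma slots_exchange N (l : 'I_N.+1 -> int) (n : 'I_N -> int) (e : int)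
    (w w' : int -> R) :
  let d (a b : int) : R := (b < a + e)%R%:R - (b < a)%R%:R in
  injective n ->
  (forall a b b', b != b' -> d a b * d a b' = 0) ->
  (forall a b, w a * d a b = w' b * d a b) ->
  \sum_i w (l i) * (slots (shift l i e) n - slots l n) =
  \sum_k w' (n k) * (slots l (shift n k (- e)) - slots l n).
Proof.
move=> d inj_n dd wd.
pose up (k : 'I_N) := widen_ord (leqnSn N) k; pose lo (k : 'I_N) := lift ord0 k.
pose ind (i j : 'I_N.+1) : R := (i == j)%:R.
pose rest k := \prod_(j | j != k) slot l n j.
have uplo k : up k != lo k.
  by apply/eqP => /(congr1 val) /=; rewrite /bump /=; lia.
have slot_l i k : slot (shift l i e) n k =
    slot l n k + (ind (up k) i - ind (lo k) i) * d (l i) (n k).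
  rewrite /slot /shift -/(up k) -/(lo k) /ind /d.
  have [<-|ui] := eqVneq (up k) i.
    by rewrite eq_sym (negbTE (uplo k)) !addr0 /= mulr0n mulr1n; ring.
  by have [<-|li] := eqVneq (lo k) i; rewrite !addr0 /= ?mulr0n ?mulr1n; ring.
have slots_l i : slots (shift l i e) n - slots l n =
    \sum_k (ind (up k) i - ind (lo k) i) * d (l i) (n k) * rest k.
  rewrite /slots; under eq_bigr do rewrite slot_l.
  rewrite prod_perturb; first by rewrite addrC addKr.
  move=> j k jk; rewrite mulrACA dd ?mulr0 //.
  by rewrite (inj_eq inj_n).
have slots_n k : slots l (shift n k (- e)) - slots l n =
    (d (l (up k)) (n k) - d (l (lo k)) (n k)) * rest k.
  rewrite /slots (bigD1 k) //= [X in _ - X](bigD1 k) //=.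
  under eq_bigr => j jk.
    have -> : slot l (shift n k (- e)) j = slot l n j.
      by rewrite /slot /shift (negbTE jk) addr0.
    over.
  rewrite -/(rest k) -mulrBl; congr (_ * _).
  rewrite /slot /shift eqxx -/(up k) -/(lo k) /d !ltrBlDr; ring.
under eq_bigr do rewrite slots_l big_distrr /=.
rewrite exchange_big /=; apply: eq_bigr => k _; rewrite slots_n mulrA mulrBr -!wd.
under eq_bigr do rewrite mulrA; rewrite -big_distrl /=; congr (_ * _).
under eq_bigr do rewrite mulrBl mulrBr.
rewrite sumrB; congr (_ - _).
  rewrite (bigD1 (up k)) //= big1 ?addr0 => [|i ik]; rewrite /ind ?eqxx ?mul1r //.
  by rewrite eq_sym (negbTE ik) mul0r mulr0.
rewrite (bigD1 (lo k)) //= big1 ?addr0 => [|i ik]; rewrite /ind ?eqxx ?mul1r //.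
by rewrite eq_sym (negbTE ik) mul0r mulr0.
Qed.

End Perturbation.

Section KernelIdentity.
Context {R : comNzRingType} (a1 a0 b1 b0 : R).

Lemma multi_eigenvalueS N : multi_eigenvalue a1 b1 N.+1 =
  multi_eigenvalue (a1 + 2) b1 N + N%:R * (a1 - b1).
Proof.
rewrite /multi_eigenvalue big_ord_recl /diff_op_eigenvalue mul0r add0r.
have -> : N%:R * (a1 - b1) = \sum_(i < N) (a1 - b1).
  by rewrite sumr_const card_ord mulr_natl.
rewrite -big_split; apply: eq_bigr => i _ /=.
by rewrite /bump /= add1n -natr1; ring.
Qed.

Lemma slots_up N (l : 'I_N.+1 -> int) n (w : int -> R) : injective n ->
  \sum_i w (l i) * (slots (shift l i 1) n - slots l n) =
  \sum_k w (n k) * (slots l (shift n k (- 1)) - slots l n).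
Proof.
move=> inj_n; have dE (a b : int) : ((b < a + 1)%R%:R - (b < a)%R%:R : R) = (a == b)%:R.
  rewrite ltzD1 le_eqVlt eq_sym; case: eqP => [->|_] /=; last by rewrite subrr.
  by rewrite ltxx subr0.
apply: slots_exchange => // [a b b' bb'|a b]; rewrite !dE.
  by case: eqP => [->|_]; rewrite ?mul0r // (negbTE bb') mulr0.
by case: eqP => [->//|_]; rewrite !mulr0.
Qed.

Lemma slots_dn N (l : 'I_N.+1 -> int) n (w : int -> R) : injective n ->
  \sum_i w (l i) * (slots (shift l i (-1)) n - slots l n) =
  \sum_k w (n k + 1) * (slots l (shift n k 1) - slots l n).
Proof.
move=> inj_n.
have dE (a b : int) : ((b < a + -1)%R%:R - (b < a)%R%:R : R) = - (a == b + 1)%:R.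
  have -> : (b < a) = (b < a - 1) || (a == b + 1) by lia.
  case: (eqVneq a (b + 1)) => [->|_]; last by rewrite orbF subrr oppr0.
  by rewrite addrK ltxx sub0r.
have /= H := slots_exchange N l n (-1) w (fun b => w (b + 1)) inj_n.
rewrite opprK in H; apply: H => [a b b' bb'|a b]; rewrite !dE.
  case: (eqVneq a (b + 1)) => [->|_]; last by rewrite oppr0 mul0r.
  by rewrite (inj_eq (addIr _)) (negbTE bb') oppr0 mulr0.
by case: eqP => [->//|_]; rewrite oppr0 !mulr0.
Qed.

(** The identity D^{(N+1)} Lambda = Lambda D^{(N)} at one entry, after the
    Vandermonde factors have been cancelled.  Replacing [a1, a0] by
    [a1 + 2, a0 + a1 + 1] replaces a(x) by a(x + 1), the effect of passing from
    z + N to z + N - 1. *)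
Lemma kernel_identity N (l : 'I_N.+1 -> int) n : injective n ->
  let al (x : int) := up_quad a1 a0 x%:~R in
  let be (x : int) := dn_quad b1 b0 x%:~R in
  let al' (x : int) := up_quad (a1 + 2) (a0 + a1 + 1) x%:~R in
  \sum_i (al (l i) * slots (shift l i 1) n + be (l i) * slots (shift l i (-1)) n)
  - (\sum_i (al (l i) + be (l i)) + multi_eigenvalue a1 b1 N.+1) * slots l n =
  \sum_k (al' (n k - 1) * slots l (shift n k (- 1))
          + be (n k + 1) * slots l (shift n k 1))
  - (\sum_k (al' (n k) + be (n k)) + multi_eigenvalue (a1 + 2) b1 N) * slots l n.
Proof.
move=> inj_n al be al'.
have hu := slots_up _ l n al inj_n; have hd := slots_dn _ l n be inj_n.
have al'E x : al' (x - 1) = al x.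
  by rewrite /al' /al /up_quad rmorphB /=; ring.
have cst : \sum_k (al' (n k) + be (n k)) =
    \sum_k al (n k) + \sum_k be (n k + 1) + N%:R * (a1 - b1).
  have -> : N%:R * (a1 - b1) = \sum_(k < N) (a1 - b1).
    by rewrite sumr_const card_ord mulr_natl.
  rewrite -!big_split; apply: eq_bigr => k _ /=.
  by rewrite /al' /al /be /up_quad /dn_quad rmorphD /=; ring.
have splitB (I : finType) (f g : I -> R) c :
    \sum_k f k * (g k - c) = \sum_k f k * g k - (\sum_k f k) * c.
  by rewrite big_distrl -sumrB; apply: eq_bigr => k _; rewrite mulrBr.
rewrite !splitB in hu hd.
rewrite multi_eigenvalueS cst; under [X in _ = X - _]eq_bigr do rewrite al'E.
rewrite [\sum_i (al (l i) + be (l i))]big_split.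
rewrite [\sum_i (al _ * _ + be _ * _)]big_split.
rewrite [\sum_k (al _ * _ + be _ * _)]big_split /= !mulrDl.
move: hu hd => /(canRL (subrK _)) -> /(canRL (subrK _)) ->; ring.
Qed.

End KernelIdentity.

(** * Coordinates of signatures *)

Section Coordinates.
Context {N : nat}.
Implicit Types (l : 'I_N -> int) (f : {ffun 'I_N -> int}).

(** Strict decrease is required between neighbours only, in the form in which
    interlacing provides it. *)
Definition decr l := forall i j : 'I_N, j = i.+1 :> nat -> l j < l i.

Lemma decr_gap l : decr l -> forall i j : 'I_N, (i <= j)%N -> l j + (j - i)%:Z <= l i.
Proof.
move=> dl i [j ltjN] /=; elim: j ltjN => [|j IH] ltjN ij.
  have -> : Ordinal ltjN = i by apply: val_inj; rewrite /=; lia.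
  by rewrite /= sub0n addr0.
have [iE|ij'] := eqVneq (i : nat) j.+1.
  have -> : Ordinal ltjN = i by apply: val_inj.
  by rewrite iE subnn addr0.
have := IH (ltnW ltjN) ltac:(lia); have := dl (Ordinal (ltnW ltjN)) (Ordinal ltjN) erefl.
lia.
Qed.

Lemma decr_lt l : decr l -> forall i j : 'I_N, (i < j)%N -> l j < l i.
Proof. by move=> dl i j ij; have := decr_gap l dl i j (ltnW ij); lia. Qed.

Lemma decr_inj l : decr l -> injective l.
Proof.
move=> dl i j lij; apply: val_inj; case: (ltngtP i j) => // ij.
  by have := decr_lt l dl i j ij; rewrite lij ltxx.
by have := decr_lt l dl j i ij; rewrite lij ltxx.
Qed.

(** [lcoord] for functions that are not known to be signatures, such as
    [add_e lam i e]. *)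
Definition coords f : 'I_N -> int := fun j => f j + N%:Z - (j.+1)%:Z.

Lemma is_signatureP f : is_signature f <-> decr (coords f).
Proof.
split=> [/forallP sf i j ij|df].
  by have := implyP (forallP (sf i) j); rewrite /coords ij => /(_ (leqnSn _)); lia.
apply/forallP => i; apply/forallP => j; apply/implyP => ij.
by have := decr_gap _ df i j ij; rewrite /coords -subzn //; lia.
Qed.

Lemma decr_lcoord (lam : GT N) : decr (lcoord lam).
Proof. by case: lam => f sf; exact/is_signatureP. Qed.

Lemma coords_inj f g : coords f =1 coords g -> f = g.
Proof. by move=> fg; apply/ffunP => i; move: (fg i) => /addIr/addIr. Qed.

Lemma lcoord_inj (lam mu : GT N) : lcoord lam =1 lcoord mu -> lam = mu.
Proof. by move=> /coords_inj /val_inj. Qed.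

Lemma coords_add_e (lam : GT N) i e :
  coords (add_e lam i e) = shift (lcoord lam) i e.
Proof. by apply: funext => j; rewrite /coords /shift /lcoord ffunE; ring. Qed.

Definition neighbour (lam : GT N) i e : option (GT N) := insub (add_e lam i e).

Variant neighbour_spec (lam : GT N) i e : option (GT N) -> Prop :=
| NeighbourSome mu of sig_val mu = add_e lam i e
    & lcoord mu = shift (lcoord lam) i e : neighbour_spec lam i e (Some mu)
| NeighbourNone of ~ decr (shift (lcoord lam) i e) : neighbour_spec lam i e None.

Lemma neighbourP lam i e : neighbour_spec lam i e (neighbour lam i e).
Proof.
rewrite /neighbour; case: insubP => [mu _ mE|sF]; constructor => //.
  by rewrite -coords_add_e -mE.
by rewrite -coords_add_e => /is_signatureP; apply/negP.
Qed.

Lemma eq_neighbour lam mu i e :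
  (sig_val mu == add_e lam i e) = (neighbour lam i e == Some mu).
Proof.
rewrite /neighbour; case: insubP => [nu _ <-|]; first by rewrite eq_sym.
move=> nsig; apply/negbTE; apply: contraNneq nsig => <-; exact: (valP mu).
Qed.

Lemma neighbour_sym lam mu i e :
  (neighbour lam i e == Some mu) = (neighbour mu i (- e) == Some lam).
Proof.
rewrite -!eq_neighbour; apply/eqP/eqP => E; apply/ffunP => j;
  move/ffunP/(_ j): E; rewrite !ffunE => ->; case: eqP => _; ring.
Qed.

End Coordinates.

Section RealCoordinates.
Context {R : realFieldType}.

Definition intrf {N} (l : 'I_N -> int) : 'I_N -> R := fun i => (l i)%:~R.

Lemma intrf_shift N (l : 'I_N -> int) i e :
  intrf (shift l i e) = shift (intrf l) i e%:~R.
Proof. by apply: funext => j; rewrite /intrf /shift rmorphD /=; case: eqP. Qed.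

Lemma vdm_gt0 N (l : 'I_N -> int) : decr l -> 0 < vdm (intrf l).
Proof.
move=> dl; apply: prodr_gt0 => i _; apply: prodr_gt0 => j ij.
by rewrite subr_gt0 ltr_int; exact: decr_lt.
Qed.

Lemma vdm_eq0 N (l : 'I_N -> R) (i j : 'I_N) : (i < j)%N -> l i = l j -> vdm l = 0.
Proof.
move=> ij lij; rewrite /vdm (bigD1 i) //= (bigD1 j) //=.
by rewrite lij subrr !mul0r.
Qed.

(** A unit shift of strictly decreasing integers either stays strictly decreasing
    or makes two of them equal.  Hence jumps that would leave the set of
    signatures have rate 0, and no rate is negative. *)
Lemma vdm_shift_ge0 N (l : 'I_N -> int) i e : decr l -> `|e| = 1 ->
  0 <= vdm (shift (intrf l) i e%:~R) /\
  (~ decr (shift l i e) -> vdm (shift (intrf l) i e%:~R) = 0).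
Proof.
move=> dl e1.
suff H : ~ decr (shift l i e) -> vdm (shift (intrf l) i e%:~R) = 0.
  split=> //; rewrite -intrf_shift.
  have [/vdm_gt0/ltW//|/H] := pselect (decr (shift l i e)).
  by rewrite -intrf_shift => ->.
move=> /existsNP[j /existsNP[k /not_implyP[jk /negP]]].
rewrite -leNgt -intrf_shift => lk.
apply: (vdm_eq0 _ _ j k); first by rewrite jk.
rewrite /intrf; congr _%:~R; have := dl j k jk; move: lk; rewrite /shift.
have : j != k by apply/eqP => /(congr1 val) /=; lia.
case: (eqVneq j i) => [->|]; case: (eqVneq k i) => [->|] //; rewrite ?eqxx //; lia.
Qed.

Lemma slots_indicator N (l : 'I_N.+1 -> int) (n : 'I_N -> int) :
  (forall k, l (lift ord0 k) <= l (widen_ord (leqnSn N) k)) ->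
  slots l n = [forall k, l (lift ord0 k) <= n k < l (widen_ord (leqnSn N) k)]%:R :> R.
Proof.
move=> dl.
have slotE k : slot l n k =
    (l (lift ord0 k) <= n k < l (widen_ord (leqnSn N) k))%R%:R :> R.
  have := dl k; rewrite /slot; set a := l _; set b := l _ => ab.
  have [nb|nb] := leP b (n k); first by rewrite (le_gtF (le_trans ab nb)) subrr andbF.
  rewrite andbT; have [na|na] := ltP (n k) a; last by rewrite subr0.
  by rewrite subrr.
rewrite /slots; under eq_bigr do rewrite slotE.
case: forallP => [all_k|/existsNP[k /negP/negbTE nk]].
  by rewrite big1 // => k _; rewrite all_k.
by rewrite (bigD1 k) //= nk mul0r.
Qed.

End RealCoordinates.

(** * The rate matrix on signatures *)

Lemma sum_option {R : pzSemiRingType} (T : eqType) (r : seq T) (o : option T) (f : T -> R) :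
  uniq r -> (forall x, o = Some x -> x \in r) ->
  \sum_(x <- r) (o == Some x)%:R * f x = oapp f 0 o.
Proof.
move=> ur; case: o => [y|] yr /=; last by rewrite big1 // => x _; rewrite mul0r.
rewrite (bigD1_seq y) ?yr //= eqxx mul1r big1 ?addr0 // => x xy.
by rewrite (_ : (Some y == Some x) = (y == x)) // eq_sym (negbTE xy) mul0r.
Qed.

Section JumpMatrix.
Context {R : realType} (a1 a0 b1 b0 : R) {N : nat}.
Implicit Types (lam mu nu : GT N) (f : GT N -> R).

Definition jump_up lam i := up_weight a1 a0 (intrf (lcoord lam)) i.
Definition jump_dn lam i := dn_weight b1 b0 (intrf (lcoord lam)) i.

Definition jump_rate lam mu : R :=
  \sum_(i < N | sig_val mu == add_e lam i 1) jump_up lam i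
  + \sum_(i < N | sig_val mu == add_e lam i (-1)) jump_dn lam i.

(** The matrix [Drate] for quadratic rates with real coefficients, as
    [Drate_jump_matrix] shows. *)
Definition jump_matrix lam mu : R :=
  if lam == mu then - \sum_(nu \in [set nu | nu != lam]) jump_rate lam nu
  else jump_rate lam mu.

Lemma jump_rateE lam mu : jump_rate lam mu =
  \sum_i ((neighbour lam i 1 == Some mu)%:R * jump_up lam i
          + (neighbour lam i (-1) == Some mu)%:R * jump_dn lam i).
Proof.
rewrite /jump_rate big_split /= [X in X + _]big_mkcond [X in _ + X]big_mkcond.
by congr (_ + _); apply: eq_bigr => i _; rewrite eq_neighbour;
  case: ifP => _; rewrite ?mul1r ?mul0r.
Qed.

Definition jump_targets lam : seq (GT N) :=
  undup (pmap id [seq neighbour lam i 1 | i : 'I_N] ++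
         pmap id [seq neighbour lam i (-1) | i : 'I_N]).

Lemma mem_jump_targets lam mu i e : e = 1 \/ e = -1 ->
  neighbour lam i e = Some mu -> mu \in jump_targets lam.
Proof.
move=> eE nE; rewrite mem_undup mem_cat !mem_pmap !map_id; apply/orP.
by case: eE nE => -> nE; [left|right]; rewrite -nE;
  apply: map_f; rewrite mem_enum.
Qed.

Lemma jump_rate_targets lam mu : mu \notin jump_targets lam -> jump_rate lam mu = 0.
Proof.
move=> nmu; rewrite jump_rateE big1 // => i _.
case: eqP => [/mem_jump_targets-/(_ (or_introl erefl))|_]; first by rewrite (negbTE nmu).
case: eqP => [/mem_jump_targets-/(_ (or_intror erefl))|_]; first by rewrite (negbTE nmu).
by rewrite !mul0r addr0.
Qed.

Lemma neighbour_neq lam i e : e != 0 ->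
  (neighbour lam i e == Some lam) = false.
Proof.
move=> e0; apply/eqP; case: neighbourP => // mu _ lE [muE]; move/negP: e0; apply.
move/(congr1 (fun g => g i)): lE; rewrite muE /shift eqxx => /eqP.
by rewrite -subr_eq0 opprD addrA subrr sub0r oppr_eq0.
Qed.

Lemma jump_rate_diag lam : jump_rate lam lam = 0.
Proof.
rewrite jump_rateE big1 // => i _.
by rewrite !neighbour_neq // !mul0r addr0.
Qed.

Lemma jump_rate_row lam f (r : seq (GT N)) : uniq r ->
  {subset jump_targets lam <= r} ->
  \sum_(mu <- r) jump_rate lam mu * f mu =
  \sum_i (jump_up lam i * oapp f 0 (neighbour lam i 1)
          + jump_dn lam i * oapp f 0 (neighbour lam i (-1))).
Proof.
move=> ur sr.
under eq_bigr do rewrite jump_rateE big_distrl /=.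
rewrite exchange_big /=; apply: eq_bigr => i _.
rewrite -!(sum_option _ _ _ _ ur) ?big_distrr -?big_split /=.
- by apply: eq_bigr => mu _; ring.
- by move=> mu nE; apply: sr; apply: (mem_jump_targets _ _ i (-1)) => //; right.
- by move=> mu nE; apply: sr; apply: (mem_jump_targets _ _ i 1) => //; left.
Qed.

Lemma jump_up_none lam i : neighbour lam i 1 = None -> jump_up lam i = 0.
Proof.
case: neighbourP => // nd _; rewrite /jump_up /up_weight.
have [_ h] := vdm_shift_ge0 (R := R) _ _ i 1 (decr_lcoord lam) (normr1 _).
by rewrite h // mul0r mulr0.
Qed.

Lemma jump_dn_none lam i : neighbour lam i (-1) = None -> jump_dn lam i = 0.
Proof.
case: neighbourP => // nd _; rewrite /jump_dn /dn_weight.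
have [_ h] := vdm_shift_ge0 (R := R) _ _ i (-1) (decr_lcoord lam) (normrN1 _).
by rewrite -[-1]/((-1)%:~R) h // mul0r mulr0.
Qed.

Definition jump_total lam := \sum_i (jump_up lam i + jump_dn lam i).

Lemma oapp_jump_up lam i (c : R) :
  jump_up lam i * oapp (fun=> c) 0 (neighbour lam i 1) = jump_up lam i * c.
Proof. by case nE : neighbour => //=; rewrite jump_up_none // !mul0r. Qed.

Lemma oapp_jump_dn lam i (c : R) :
  jump_dn lam i * oapp (fun=> c) 0 (neighbour lam i (-1)) = jump_dn lam i * c.
Proof. by case nE : neighbour => //=; rewrite jump_dn_none // !mul0r. Qed.

Lemma jump_matrixE lam mu :
  jump_matrix lam mu = jump_rate lam mu - (lam == mu)%:R * jump_total lam.
Proof.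
rewrite /jump_matrix; case: eqVneq => [<-|_]; last by rewrite mul0r subr0.
rewrite jump_rate_diag sub0r mul1r; congr (- _).
rewrite (fsbig_widen _ [set: GT N]) //; last first.
  by move=> nu /= [_ /negP]; rewrite negbK => /eqP ->; exact: jump_rate_diag.
have ur : uniq (jump_targets lam) by exact: undup_uniq.
transitivity (act jump_rate (fun=> 1) lam).
  by apply: eq_fsbigr => nu _; rewrite mulr1.
rewrite (actE _ _ _ ur); last exact: jump_rate_targets.
rewrite jump_rate_row //; apply: eq_bigr => i _.
by rewrite oapp_jump_up oapp_jump_dn !mulr1.
Qed.

Definition jump_support lam := undup (lam :: jump_targets lam).

Lemma jump_support_uniq lam : uniq (jump_support lam).
Proof. exact: undup_uniq. Qed.

Lemma jump_matrix_support lam mu : mu \notin jump_support lam -> jump_matrix lam mu = 0.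
Proof.
rewrite mem_undup inE negb_or jump_matrixE eq_sym => /andP[/negbTE -> nmu].
by rewrite mul0r subr0 jump_rate_targets.
Qed.

Lemma jump_matrix_row lam f : act jump_matrix f lam =
  \sum_i (jump_up lam i * oapp f 0 (neighbour lam i 1)
          + jump_dn lam i * oapp f 0 (neighbour lam i (-1))) - jump_total lam * f lam.
Proof.
have ur := jump_support_uniq lam.
rewrite (actE _ _ _ ur (jump_matrix_support lam)).
under eq_bigr do rewrite jump_matrixE mulrBl.
rewrite sumrB jump_rate_row //; last first.
  by move=> mu h; rewrite mem_undup inE h orbT.
congr (_ - _); rewrite (bigD1_seq lam) //= ?mem_undup ?mem_head //.
rewrite eqxx mul1r big1 ?addr0 // => mu mulam.
by rewrite eq_sym (negbTE mulam) !mul0r.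
Qed.

Lemma jump_matrix_col (g : GT N -> R) (r : seq (GT N)) nu : uniq r ->
  {subset jump_support nu <= r} ->
  \sum_(ka <- r) g ka * jump_matrix ka nu =
  \sum_i (oapp (fun ka => g ka * jump_up ka i) 0 (neighbour nu i (-1))
          + oapp (fun ka => g ka * jump_dn ka i) 0 (neighbour nu i 1))
  - g nu * jump_total nu.
Proof.
move=> ur sr; have sr' ka : ka \in jump_targets nu -> ka \in r.
  by move=> h; apply: sr; rewrite mem_undup inE h orbT.
under eq_bigr do rewrite jump_matrixE mulrBr.
rewrite sumrB; congr (_ - _); last first.
  rewrite (bigD1_seq nu) //= ?sr ?mem_undup ?mem_head //.
  by rewrite eqxx mul1r big1 ?addr0 // => mu /negbTE ->; rewrite mul0r mulr0.
under eq_bigr do rewrite jump_rateE big_distrr /=.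
rewrite exchange_big /=; apply: eq_bigr => i _.
rewrite -!(sum_option _ _ _ _ ur) -?big_split /=.
- apply: eq_bigr => ka _; rewrite neighbour_sym [neighbour ka i (-1) == _]neighbour_sym.
  by rewrite opprK; ring.
- by move=> mu nE; apply: sr'; apply: (mem_jump_targets _ _ i 1) => //; left.
- by move=> mu nE; apply: sr'; apply: (mem_jump_targets _ _ i (-1)) => //; right.
Qed.

Hypothesis up_pos : forall x : int, 0 < up_quad a1 a0 x%:~R.
Hypothesis dn_pos : forall x : int, 0 < dn_quad b1 b0 x%:~R.

Lemma jump_matrix_conservative : conservative jump_matrix.
Proof.
split=> [lam|lam mu lammu|lam].
- exists (jump_support lam); split; first exact: jump_support_uniq.
  exact: jump_matrix_support.
- rewrite jump_matrixE (negbTE lammu) mul0r subr0.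
  have v0 := vdm_gt0 (R := R) _ _ (decr_lcoord lam).
  apply: addr_ge0; apply: sumr_ge0 => i _.
    rewrite mulr_ge0 ?(ltW (up_pos _)) // divr_ge0 ?(ltW v0) //.
    exact: (vdm_shift_ge0 (R := R) _ _ i 1 (decr_lcoord lam) (normr1 _)).1.
  rewrite mulr_ge0 ?(ltW (dn_pos _)) // divr_ge0 ?(ltW v0) //.
  exact: (vdm_shift_ge0 (R := R) _ _ i (-1) (decr_lcoord lam) (normrN1 _)).1.
- rewrite jump_matrix_row mulr1 /jump_total -sumrB big1 // => i _.
  by rewrite oapp_jump_up oapp_jump_dn !mulr1 subrr.
Qed.

Lemma jump_matrix_gen (F : ('I_N -> R) -> R) lam :
  act jump_matrix (fun mu => F (intrf (lcoord mu))) lam =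
  gen a1 a0 b1 b0 F (intrf (lcoord lam)).
Proof.
rewrite jump_matrix_row /jump_total big_distrl -sumrB /gen.
apply: eq_bigr => i _ /=; rewrite -/(jump_up lam i) -/(jump_dn lam i).
have -> : jump_up lam i * oapp (fun mu => F (intrf (lcoord mu))) 0 (neighbour lam i 1)
    = jump_up lam i * F (shift (intrf (lcoord lam)) i 1).
  case nE : neighbour => [mu|] /=; last by rewrite jump_up_none // !mul0r.
  by move: nE; case: neighbourP => // nu _ lE [<-]; rewrite lE intrf_shift.
have -> : jump_dn lam i * oapp (fun mu => F (intrf (lcoord mu))) 0 (neighbour lam i (-1))
    = jump_dn lam i * F (shift (intrf (lcoord lam)) i (-1)).
  case nE : neighbour => [mu|] /=; last by rewrite jump_dn_none // !mul0r.
  by move: nE; case: neighbourP => // nu _ lE [<-]; rewrite lE intrf_shift.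
ring.
Qed.

End JumpMatrix.

Lemma finite_signature_box N (lo : 'I_N -> int) (M : nat) :
  finite_set [set lam : GT N | forall i, lo i <= lam i <= lo i + M%:Z].
Proof.
pose box (h : {ffun 'I_N -> 'I_M.+1}) : {ffun 'I_N -> int} :=
  [ffun i => lo i + (h i : nat)%:Z].
apply: (@sub_finite_set _ _ [set` pmap (insub : _ -> option (GT N))
  [seq box h | h : {ffun 'I_N -> 'I_M.+1}]]).
  move=> lam lamP /=; rewrite mem_pmap; apply/mapP; exists (sig_val lam).
    apply/mapP; exists [ffun i => inord (absz (lam i - lo i)%R)]; first by rewrite mem_enum.
    apply/ffunP => i; have /andP[h1 h2] := lamP i.
    have d0 : 0 <= lam i - lo i by rewrite subr_ge0.
    rewrite !ffunE inordK ?gez0_abs //; first by rewrite addrC subrK.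
    by rewrite ltnS -lez_nat gez0_abs // lerBlDl.
  by rewrite valK.
exact: finite_seq.
Qed.

Lemma jump_matrix_lyapunov {R : realType} (a1 a0 b1 b0 : R) N : exists C : R,
  lyapunov (jump_matrix a1 a0 b1 b0)
    (fun lam : GT N.+2 => quad_energy (intrf (lcoord lam))) C.
Proof.
have [C [C0 CP]] := quad_energy_lyapunov a1 a0 b1 b0 N.
exists C; split=> // [lam|M|lam].
- exact: le_trans ler01 (quad_energy_ge1 _ _).
- pose K := Num.truncn `|M|.
  apply: sub_finite_set (finite_signature_box N.+2
     (fun i => (i.+1)%:Z - (N.+2)%:Z - K.+1%:Z) (K.+1 * 2)) => lam /= lamM i.
  have : (lcoord lam i) ^+ 2 < K.+1%:Z.
    rewrite -(ltr_int R); apply: le_lt_trans (truncnS_gt `|M|).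
    apply: le_trans (ler_norm M); apply: le_trans lamM.
    rewrite /quad_energy (bigD1 i) //= /intrf rmorphXn /=.
    rewrite addrCA lerDl addr_ge0 // sumr_ge0 // => j _; exact: sqr_ge0.
  rewrite /lcoord; nia.
- rewrite jump_matrix_gen; apply: CP.
  by rewrite gt_eqF // vdm_gt0 //; exact: decr_lcoord.
Qed.

(** * The kernel Lambda *)

Section InterlacingKernel.
Context {R : realType} {N : nat}.
Implicit Types (lam : GT N.+1) (nu : GT N).

Let up (k : 'I_N) : 'I_N.+1 := widen_ord (leqnSn N) k.
Let lo (k : 'I_N) : 'I_N.+1 := lift ord0 k.

Definition in_slots (l : 'I_N.+1 -> int) (n : 'I_N -> int) : bool :=
  [forall k, l (lo k) <= n k < l (up k)].

Lemma decr_up_lo (l : 'I_N.+1 -> int) : (forall k, l (lo k) < l (up k)) -> decr l.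
Proof.
move=> h i j ij; have iN : (i < N)%N by have := ltn_ord j; lia.
have -> : i = up (Ordinal iN) by apply: val_inj.
by have -> : j = lo (Ordinal iN) by apply: val_inj; rewrite /= ij.
Qed.

Lemma decr_lo_up (l : 'I_N.+1 -> int) k : decr l -> l (lo k) < l (up k).
Proof. by move=> dl; apply: dl. Qed.

Lemma slots_shift_none (l : 'I_N.+1 -> int) n i e : decr l -> `|e| = 1 ->
  ~ decr (shift l i e) -> slots (shift l i e) n = 0 :> R.
Proof.
move=> dl e1 nd; rewrite slots_indicator.
  case: forallP => // h; case: nd; apply: decr_up_lo => k.
  by have /andP[] := h k; exact: le_lt_trans.
move=> k; have := decr_lo_up l k dl; rewrite -/(lo k) -/(up k) /shift.
have uplo : up k != lo k by apply/eqP => /(congr1 val) /=; rewrite /bump /=; lia.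
case: (eqVneq (lo k) i) => [lk|_]; case: (eqVneq (up k) i) => [uk|_]; lia.
Qed.

Lemma slots_decr_right (l : 'I_N.+1 -> int) n : decr l -> ~ decr n ->
  slots l n = 0 :> R.
Proof.
move=> dl nd; rewrite slots_indicator; last by move=> k; apply/ltW; exact: decr_lo_up.
case: forallP => // h; case: nd => i j ij.
have /andP[li _] := h i; have /andP[_ lj] := h j; apply: (lt_le_trans lj).
by move: li; have -> // : lift ord0 i = widen_ord (leqnSn N) j by apply: val_inj.
Qed.

Lemma interlaceE lam nu : interlace nu lam = in_slots (lcoord lam) (lcoord nu).
Proof.
apply: eq_forallb => k; rewrite /lcoord andbC -/(up k) -/(lo k).
have -> : (lo k).+1%:Z = k.+2%:Z by [].
have -> : (up k).+1%:Z = k.+1%:Z by [].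
by congr (_ && _); apply/idP/idP; lia.
Qed.

Definition dim_const n : R := \prod_(1 <= i < n) (i`!)%:R.

Lemma dim_const_gt0 n : 0 < dim_const n.
Proof. by apply: prodr_gt0 => i _; rewrite ltr0n fact_gt0. Qed.

Lemma DimE n (lam : GT n) : Dim lam = vdm (intrf (lcoord lam)) / dim_const n :> R.
Proof.
rewrite /Dim -/(dim_const n); congr (_ / _).
apply: eq_bigr => i _; apply: eq_bigr => j _.
rewrite /intrf -rmorphB; congr _%:~R; rewrite /lcoord.
by rewrite !intS; ring.
Qed.

Definition kernel_const : R := dim_const N.+1 / dim_const N.

Lemma LambdaE lam nu : Lambda lam nu =
  slots (lcoord lam) (lcoord nu) *
  (kernel_const * vdm (intrf (lcoord nu)) / vdm (intrf (lcoord lam))) :> R.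
Proof.
rewrite slots_indicator; last by move=> k; apply/ltW; exact/decr_lo_up/decr_lcoord.
rewrite /Lambda interlaceE -/(in_slots _ _); case: ifP => _; last by rewrite mul0r.
have k1 := lt0r_neq0 (dim_const_gt0 N.+1); have k0 := lt0r_neq0 (dim_const_gt0 N).
have v1 := lt0r_neq0 (vdm_gt0 (R := R) _ _ (decr_lcoord lam)).
by rewrite mul1r !DimE /kernel_const; field; rewrite k0 k1 v1.
Qed.

Lemma Lambda_ge0 lam nu : 0 <= Lambda lam nu :> R.
Proof.
rewrite /Lambda; case: ifP => // _; rewrite !DimE.
by rewrite !divr_ge0 // ltW // ?vdm_gt0 ?dim_const_gt0 //; exact: decr_lcoord.
Qed.

Lemma Lambda_row_finite : row_finite (@Lambda R N).
Proof.
move=> lam.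
have [r [ur rE]] := finite_uniq_seq _ _
  (finite_signature_box N (fun i => lam (lo i)) (absz (lam ord0 - lam ord_max))).
exists r; split=> // nu; rewrite /Lambda; case: ifP => // /forallP inl nur.
suff : nu \in r by rewrite (negbTE nur).
have mono (i j : 'I_N.+1) : (i <= j)%N -> lam j <= lam i.
  by case: (lam) => f /= /forallP/(_ i)/forallP/(_ j)/implyP.
suff : [set` r] nu by [].
rewrite -rE /= => i; have /andP[h1 h2] := inl i.
have := mono ord0 (up i) (leq0n _); have := mono (lo i) ord_max (leq_ord _).
rewrite -/(up i) -/(lo i) in h1 h2 *; lia.
Qed.

(** A pair a < b of indices in 0..N is a pair (up i, lo j) with i <= j. *)
Lemma vdm_split (l : 'I_N.+1 -> R) : vdm l =
  (\prod_k (l (up k) - l (lo k))) *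
  \prod_(i < N) \prod_(j < N | (i < j)%N) (l (up i) - l (lo j)).
Proof.
rewrite /vdm big_ord_recr /= [X in _ * X]big_pred0 ?mulr1; last first.
  by move=> j; rewrite ltnNge leq_ord.
rewrite -big_split; apply: eq_bigr => i _ /=.
rewrite big_mkcond big_ord_recl /= mul1r -big_mkcond /=.
rewrite (bigD1 i) /=; last by rewrite /bump.
congr (_ * _); apply: eq_bigl => j.
by rewrite /bump /= add1n ltnS ltn_neqAle andbC eq_sym.
Qed.

Lemma in_slots_count (l : 'I_N.+1 -> int) (s : seq (GT N)) : decr l -> uniq s ->
  (forall nu, nu \in s -> in_slots l (lcoord nu)) ->
  (size s)%:R <= \prod_k ((l (up k))%:~R - (l (lo k))%:~R) :> R.
Proof.
move=> dl us sl.
pose d k := absz (l (up k) - l (lo k)).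
have dE k : (d k)%:Z = l (up k) - l (lo k).
  by rewrite /d gez0_abs // subr_ge0 ltW // decr_lo_up.
have -> : \prod_k ((l (up k))%:~R - (l (lo k))%:~R) = (\prod_k d k)%N%:R :> R.
  by rewrite natr_prod; apply: eq_bigr => k _; rewrite -rmorphB -dE.
rewrite ler_nat; pose M := \max_k d k.
have dM k : (d k <= M)%N by exact: leq_bigmax.
(* The offsets inside the intervals determine the signature. *)
pose code (nu : GT N) : {ffun 'I_N -> 'I_M.+1} :=
  [ffun k => inord (absz (lcoord nu k - l (lo k))%R)].
have code_lt nu k : nu \in s -> (absz (lcoord nu k - l (lo k))%R < d k)%N.
  move=> /sl/forallP/(_ k)/andP[h1 h2]; have := dE k; lia.
have code_inj : {in s &, injective code}.
  move=> nu1 nu2 s1 s2 /ffunP c12; apply: lcoord_inj => k.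
  move: (c12 k); rewrite !ffunE => /(congr1 val).
  have lt1 := code_lt nu1 k s1; have lt2 := code_lt nu2 k s2.
  rewrite /= !inordK ?ltnS ?(leq_trans (ltnW lt1)) ?(leq_trans (ltnW lt2)) //.
  have /forallP/(_ k)/andP[h1 _] := sl _ s1; have /forallP/(_ k)/andP[h2 _] := sl _ s2.
  lia.
rewrite -(size_map code) -(card_uniqP _); last by rewrite map_inj_in_uniq.
pose F (k : 'I_N) : pred 'I_M.+1 := fun x => (x < d k)%N.
apply: (@leq_trans #|family F|).
  apply: subset_leq_card; apply/fintype.subsetP => _ /mapP[nu nus ->].
  apply/familyP => k; rewrite unfold_in /F ffunE inordK ?code_lt //.
  by rewrite ltnS (leq_trans (ltnW (code_lt nu k nus))).
rewrite card_family foldrE big_image /=; apply: leq_prod => k _.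
have /leq_trans-> // : (#|F k| <= size [seq (inord x : 'I_M.+1) | x <- iota 0 (d k)])%N.
  apply: leq_trans (card_size _); apply: subset_leq_card.
  apply/fintype.subsetP => x xd; apply/mapP; exists (x : nat); last by rewrite inord_val.
  by rewrite mem_iota.
by rewrite size_map size_iota.
Qed.

(** Each factor of [vdm] at the coordinates of [nu] is at most the distance from
    the top of one interval to the bottom of a later one, and the number of
    admissible [nu] is at most the product of the interval lengths.  Together
    these factors are exactly those of [vdm] at the coordinates of [lam]. *)
Lemma Lambda_row_sum lam : act (@Lambda R N) (fun=> 1) lam <= kernel_const.
Proof.
have [r [ur hr]] := Lambda_row_finite lam; rewrite (actE _ _ _ ur hr).
set l := lcoord lam; have dl : decr l := decr_lcoord lam.
have vl := vdm_gt0 (R := R) _ _ dl.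
have kc0 : 0 <= kernel_const by rewrite divr_ge0 // ltW // dim_const_gt0.
pose W : R := \prod_(i < N) \prod_(j < N | (i < j)%N) (intrf l (up i) - intrf l (lo j)).
have W0 : 0 <= W.
  apply: prodr_ge0 => i _; apply: prodr_ge0 => j ij.
  by rewrite subr_ge0 ler_int ltW // decr_lt //= /bump; lia.
have bound nu : Lambda lam nu <=
    (if in_slots l (lcoord nu) then 1 else 0) * (kernel_const * W / vdm (intrf l)).
  rewrite LambdaE slots_indicator -/(in_slots _ _); last first.
    by move=> k; apply/ltW; exact: decr_lo_up.
  case: ifP => [/forallP nl|_]; last by rewrite !mul0r.
  rewrite !mul1r ler_wpM2r ?invr_ge0 ?(ltW vl) // ler_wpM2l //.
  apply: ler_prod => i _; have dn := decr_lcoord nu; apply/andP; split.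
    by apply: prodr_ge0 => j ij; rewrite subr_ge0 ler_int ltW // decr_lt.
  apply: ler_prod => j ij; rewrite subr_ge0 ler_int ltW ?decr_lt //=.
  have /andP[_ h1] := nl i; have /andP[h2 _] := nl j.
  by rewrite lerB // ler_int // ltW.
apply: (@le_trans _ _ (\sum_(nu <- r) (if in_slots l (lcoord nu) then 1 else 0) *
    (kernel_const * W / vdm (intrf l)))).
  by apply: ler_sum => nu _; rewrite mulr1.
rewrite -big_distrl -big_mkcond -big_filter big_const_seq count_predT iter_addr addr0 /=.
apply: (@le_trans _ _ ((\prod_k (intrf l (up k) - intrf l (lo k))) *
    (kernel_const * W / vdm (intrf l)))).
  rewrite ler_wpM2r ?(divr_ge0 (mulr_ge0 kc0 W0) (ltW vl)) //.
  apply: (in_slots_count l _ dl) => //; first exact: filter_uniq.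
  by move=> nu; rewrite mem_filter => /andP[].
rewrite mulrA mulrCA -/W -vdm_split mulfK // gt_eqF //.
Qed.

End InterlacingKernel.

(** * The intertwining identity and the theorem *)

Lemma neighbour_some N (lam mu : GT N) i e : neighbour lam i e = Some mu ->
  lcoord mu = shift (lcoord lam) i e.
Proof. by case: neighbourP => // nu _ lE [<-]. Qed.

Lemma neighbour_none N (lam : GT N) i e : neighbour lam i e = None ->
  ~ decr (shift (lcoord lam) i e).
Proof. by case: neighbourP. Qed.

(** In both products the Vandermonde factor of the intermediate signature cancels
    against the one in the jump rate, which leaves a common factor times the two
    sides of [kernel_identity].  Intermediate points that are not signatures
    contribute 0 to these sides. *)
Lemma Lambda_intertwines {R : realType} (a1 a0 b1 b0 : R) N
    (lam : GT N.+1) (nu : GT N) :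
  act (jump_matrix a1 a0 b1 b0) (fun la => Lambda la nu) lam =
  act (@Lambda R N) (fun ka => jump_matrix (a1 + 2) (a0 + a1 + 1) b1 b0 ka nu) lam.
Proof.
set l := lcoord lam; set n := lcoord nu.
have dl : decr l := decr_lcoord lam; have dn : decr n := decr_lcoord nu.
have vl := lt0r_neq0 (vdm_gt0 (R := R) _ _ dl).
have vn := lt0r_neq0 (vdm_gt0 (R := R) _ _ dn).
pose A : R := kernel_const (N := N) * vdm (intrf n) / vdm (intrf l).
have LE : Lambda lam nu = slots l n * A by exact: LambdaE.
have intr1 : (-1)%:~R = -1 :> R by [].
pose al (x : int) : R := up_quad a1 a0 x%:~R.
pose be (x : int) : R := dn_quad b1 b0 x%:~R.
pose al' (x : int) : R := up_quad (a1 + 2) (a0 + a1 + 1) x%:~R.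
have rowE : act (jump_matrix a1 a0 b1 b0) (fun la => Lambda la nu) lam = A *
  (\sum_i (al (l i) * slots (shift l i 1) n + be (l i) * slots (shift l i (-1)) n)
   - (\sum_i (al (l i) + be (l i)) + multi_eigenvalue a1 b1 N.+1) * slots l n).
  rewrite jump_matrix_row [jump_total _ _ _ _ _]total_weight //.
  rewrite mulrBr LE [A * (_ * _)]mulrCA [A * slots _ _]mulrC; congr (_ - _).
  rewrite big_distrr; apply: eq_bigr => i _ /=; rewrite mulrDr; congr (_ + _).
    case nE : neighbour => [mu|] /=.
      rewrite LambdaE (neighbour_some _ _ _ _ _ nE) -/l -/n.
      have := lt0r_neq0 (vdm_gt0 (R := R) _ _ (decr_lcoord mu)).
      rewrite (neighbour_some _ _ _ _ _ nE) -/l intrf_shift => vm.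
      by rewrite /jump_up /up_weight -/l /A /al /intrf -/(intrf l); field; rewrite vl vm.
    by rewrite slots_shift_none ?mulr0 //; exact: neighbour_none nE.
  case nE : neighbour => [mu|] /=.
    rewrite LambdaE (neighbour_some _ _ _ _ _ nE) -/l -/n.
    have := lt0r_neq0 (vdm_gt0 (R := R) _ _ (decr_lcoord mu)).
    rewrite (neighbour_some _ _ _ _ _ nE) -/l intrf_shift => vm.
    by rewrite /jump_dn /dn_weight -/l /A /be /intrf -/(intrf l); field; rewrite vl vm.
  by rewrite slots_shift_none ?mulr0 //; exact: neighbour_none nE.
rewrite rowE kernel_identity; last exact: decr_inj.
have [r0 [_ hr0]] := Lambda_row_finite (R := R) lam.
pose r := undup (r0 ++ jump_support nu).
have ur : uniq r := undup_uniq _.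
have hr ka : ka \notin r -> Lambda lam ka = 0 :> R.
  by rewrite mem_undup mem_cat negb_or => /andP[/hr0].
rewrite (actE _ _ _ ur hr) jump_matrix_col //; last first.
  by move=> ka h; rewrite mem_undup mem_cat h orbT.
rewrite LE [jump_total _ _ _ _ _]total_weight // mulrBr.
rewrite [X in _ - X = _]mulrCA [A * slots _ _]mulrC [X in _ - X = _]mulrC; congr (_ - _).
rewrite big_distrr; apply: eq_bigr => k _ /=; rewrite mulrDr; congr (_ + _).
  case nE : neighbour => [ka|] /=; last first.
    by rewrite slots_decr_right ?mulr0 //; exact: neighbour_none nE.
  have kE := neighbour_some _ _ _ _ _ nE; rewrite -/n in kE.
  have vk := lt0r_neq0 (vdm_gt0 (R := R) _ _ (decr_lcoord ka)).
  have back : shift (intrf (lcoord ka)) k 1 = intrf n :> ('I_N -> R).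
    rewrite -[1]/(1%:~R) -intrf_shift kE; congr intrf; apply: funext => j.
    by rewrite /shift; case: eqP => _; rewrite ?addr0 // subrK.
  rewrite LambdaE -/l /jump_up /up_weight back -kE.
  have -> : intrf (lcoord ka) k = (n k - 1)%:~R :> R.
    by rewrite /intrf kE /shift eqxx.
  rewrite /A; field; rewrite vl vk //.
case nE : neighbour => [ka|] /=; last first.
  by rewrite slots_decr_right ?mulr0 //; exact: neighbour_none nE.
have kE := neighbour_some _ _ _ _ _ nE; rewrite -/n in kE.
have vk := lt0r_neq0 (vdm_gt0 (R := R) _ _ (decr_lcoord ka)).
have back : shift (intrf (lcoord ka)) k (-1) = intrf n :> ('I_N -> R).
  rewrite -intr1 -intrf_shift kE; congr intrf; apply: funext => j.
  by rewrite /shift; case: eqP => _; rewrite ?addr0 // addrK.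
rewrite LambdaE -/l /jump_dn /dn_weight back -kE.
have -> : intrf (lcoord ka) k = (n k + 1)%:~R :> R.
  by rewrite /intrf kE /shift eqxx.
rewrite /A; field; rewrite vl vk //.
Qed.

(** The values at k = 0 and k = 1 are real, and they determine [x x'] and
    [x + x']. *)
Lemma sum_prod_real {R : realType} (x x' : R[i]) :
  (forall k : int, 0 < (x + k%:~R) * (x' + k%:~R)) ->
  exists s p : R, x + x' = real_complex R s /\ x * x' = real_complex R p.
Proof.
move=> hx.
have rp : x * x' \is Num.real.
  by have := gtr0_real (hx 0); rewrite !addr0.
have rs : x + x' \is Num.real.
  have -> : x + x' = (x + 1%:~R) * (x' + 1%:~R) - x * x' - 1.
    by rewrite -[1%:~R]/(1 : R[i]); ring.
  apply: realB; last exact: real1.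
  by apply: realB => //; exact: (gtr0_real (hx 1)).
by exists (complex.Re (x + x')), (complex.Re (x * x')); rewrite !RRe_real.
Qed.

Lemma Drate_jump_matrix {R : realType} N (a1 a0 b1 b0 : R) (u u' w w' : R[i]) :
  u + u' = real_complex R (- a1) -> u * u' = real_complex R a0 ->
  w + w' = real_complex R b1 -> w * w' = real_complex R b0 ->
  @Drate R u u' w w' N = jump_matrix a1 a0 b1 b0.
Proof.
move=> us up ws wp.
have intC (x : int) : x%:~R = real_complex R x%:~R :> R[i] by rewrite rmorph_int.
have ratioC (lam : GT N) i (e : int) :
    \prod_(j < N | j != i) (((lcoord lam i)%:~R + e%:~R - (lcoord lam j)%:~R) /
      ((lcoord lam i)%:~R - (lcoord lam j)%:~R)) =
    real_complex R (vdm (shift (intrf (lcoord lam)) i e%:~R)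
      / vdm (intrf (lcoord lam))) :> R[i].
  rewrite vdm_shift_ratio; last by rewrite gt_eqF // vdm_gt0 //; exact: decr_lcoord.
  rewrite rmorph_prod; apply: eq_bigr => j _ /=.
  rewrite /intrf; move: (lcoord lam i) (lcoord lam j) => a b.
  by rewrite !intC fmorph_div /= !rmorphB rmorphD.
have upC (lam : GT N) i :
    rate_up u u' lam i = real_complex R (jump_up a1 a0 lam i).
  rewrite /rate_up /jump_up /up_weight rmorphM /= -(ratioC lam i 1); congr (_ * _).
  rewrite /up_quad /intrf; move: (lcoord lam i) => x.
  rewrite 2!rmorphD rmorphXn rmorphM /= -up -intC.
  have -> : real_complex R a1 = - (u + u') by rewrite us rmorphN opprK.
  by ring.
have dnC (lam : GT N) i :
    rate_down w w' lam i = real_complex R (jump_dn b1 b0 lam i).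
  rewrite /rate_down /jump_dn /dn_weight rmorphM /= -(ratioC lam i (-1)); congr (_ * _).
  rewrite /dn_quad /intrf; move: (lcoord lam i) => x.
  rewrite 2!rmorphD rmorphXn rmorphM /= -wp -ws -intC.
  by ring.
have offC (lam mu : GT N) :
    Doff u u' w w' lam mu = real_complex R (jump_rate a1 a0 b1 b0 lam mu).
  rewrite /Doff /jump_rate rmorphD !rmorph_sum /=.
  by congr (_ + _); apply: eq_bigr => i _.
apply: funext => lam; apply: funext => mu; rewrite /Drate /Dmat /jump_matrix.
case: ifP => _; last by rewrite offC.
have [r [ur rl hr]] : exists r : seq (GT N), [/\ uniq r,
    [set` r] `<=` [set nu | nu != lam]
    & forall nu, nu != lam -> nu \notin r -> jump_rate a1 a0 b1 b0 lam nu = 0].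
  exists [seq nu <- jump_targets lam | nu != lam]; split.
  - by rewrite filter_uniq // undup_uniq.
  - by move=> nu /=; rewrite mem_filter => /andP[].
  - by move=> nu nl; rewrite mem_filter nl /= => /jump_rate_targets.
rewrite !(fsbigE r) //; last by move=> nu nl nr; rewrite offC hr.
rewrite raddfN raddf_sum; congr (- _); apply: eq_bigr => nu _.
by rewrite offC.
Qed.

Theorem theorem6p1 (R : realType) (z z' w w' : R[i])
  (hz : forall k : int, 0 < (z + k%:~R) * (z' + k%:~R))
  (hw : forall k : int, 0 < (w + k%:~R) * (w' + k%:~R))
  (hsum : -1 < z + z' + w + w')
  (P : forall N : nat, R -> GT N -> GT N -> R)
  (hP : forall N : nat, (1 <= N)%N ->
     minimal_backward_solution
       (@Drate R (z + N%:R - 1) (z' + N%:R - 1) w w' N) (P N)) :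
  forall (t : R) (N : nat), 0 <= t -> (1 <= N)%N ->
  forall (lam : GT N.+1) (nu : GT N),
    kernel_mul (P N.+1 t) (@Lambda R N) lam nu =
    kernel_mul (@Lambda R N) (P N t) lam nu.
Proof.
move=> t N t0 N1 lam nu.
have [s [p [sE pE]]] := sum_prod_real _ _ hz.
have [b1 [b0 [b1E b0E]]] := sum_prod_real _ _ hw.
have natC (x : nat) : x%:R = real_complex R x%:R :> R[i] by rewrite rmorph_nat.
have intC (x : int) : x%:~R = real_complex R x%:~R :> R[i] by rewrite rmorph_int.
(* The coefficients of (x - z - M)(x - z' - M), for signatures of length M+1. *)
pose a1 M : R := - (s + 2 * M%:R); pose a0 M : R := p + M%:R * s + M%:R ^+ 2.
have rate M : @Drate R (z + M.+1%:R - 1) (z' + M.+1%:R - 1) w w' M.+1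
    = jump_matrix (a1 M) (a0 M) b1 b0.
  apply: Drate_jump_matrix => //.
    rewrite /a1 opprK rmorphD rmorphM /= -sE -!natC -natr1; ring.
  rewrite /a0 2!rmorphD rmorphXn rmorphM /= -sE -pE -!natC -natr1; ring.
have up_pos M (x : int) : 0 < up_quad (a1 M) (a0 M) x%:~R.
  rewrite -ltcR; have := hz (M%:Z - x); congr (0 < _).
  have -> : up_quad (a1 M) (a0 M) x%:~R =
      (M%:R - x%:~R) ^+ 2 + (M%:R - x%:~R) * s + p by rewrite /up_quad /a1 /a0; ring.
  have -> : real_complex R ((M%:R - x%:~R) ^+ 2 + (M%:R - x%:~R) * s + p) =
      (M%:R - x%:~R) ^+ 2 + (M%:R - x%:~R) * (z + z') + z * z'.
    by rewrite 2!rmorphD rmorphXn rmorphM /= rmorphB /= -natC -intC -sE -pE.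
  by rewrite rmorphB /= -pmulrn; ring.
have dn_pos (x : int) : 0 < dn_quad b1 b0 x%:~R.
  rewrite -ltcR; have := hw x; congr (0 < _).
  by rewrite /dn_quad 2!rmorphD rmorphXn rmorphM /= -b1E -b0E -intC; ring.
case: N N1 lam nu => [//|N] _ lam nu.
have a1S : a1 N.+1 + 2 = a1 N by rewrite /a1 -natr1; ring.
have a0S : a0 N.+1 + a1 N.+1 + 1 = a0 N by rewrite /a0 /a1 -natr1; ring.
have minN : minimal_backward_solution
    (jump_matrix (a1 N.+1 + 2) (a0 N.+1 + a1 N.+1 + 1) b1 b0) (P N.+1).
  by have := hP N.+1 isT; rewrite rate a1S a0S.
have minN1 := hP N.+2 isT; rewrite rate in minN1.
have [C lyapC] := jump_matrix_lyapunov (a1 N.+1) (a0 N.+1) b1 b0 N.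
apply: (minimal_solution_intertwining _ _ _ _ _ _ _ _ Lambda_row_sum _ _ _
  minN1 minN _ C lyapC) => //.
- exact: jump_matrix_conservative.
- by rewrite a1S a0S; exact: jump_matrix_conservative.
- exact: Lambda_row_finite.
- exact: Lambda_ge0.
- exact: Lambda_intertwines.
Qed.
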